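(* Let $\Omega\subset\mathbb{R}^d$ be an open set, let $\ell$ be an integer with $0\le\ell\le d$, and let $\sigma\in\mathcal{M}(\Omega)$ be a positive measure. Assume that, at $\sigma^s$-almost every $x\in\Omega$, every tangent measure $\tau\in\mathrm{Tan}(\sigma^s,x)$ can be split on $B_1$ as a finite sum, that is, as measures on $B_1$, $$\tau=(\tau_1+\dots+\tau_k)\llcorner B_1,\qquad k=k(\sigma)\in\mathbb{N},$$ where, for each $1\le h\le k$, $\tau_h\in\mathcal{M}(\mathbb{R}^d)$ is a $V_h$-invariant measure for some linear subspace $V_h\subset\mathbb{R}^d$ of dimension $\ell_h\ge\ell$. Then $$\dim_{\mathcal H}(\sigma)\ \ge\ \ell.$$
   Context: $\mathcal{M}(\Omega)$ denotes the space of real-valued (locally finite) Radon measures on $\Omega$. $\sigma^s$ is the singular part of $\sigma$ in its Lebesgue decomposition with respect to Lebesgue measure. $B_r(x)$ is the open ball of radius $r$ centered at $x$, and $B_1=B_1(0)$. Let $T^{r,x}(y)=(y-x)/r$. For a measure $\mu$, $\tau\in\mathrm{Tan}(\mu,x)$ (a probability, or bounded, tangent measure of $\mu$ at $x$) means that there is a sequence $r_j\downarrow 0$ such that $\gamma_j:=\frac{1}{|\mu|(B_{r_j}(x))}(T^{r_j,x}_\#\mu)\llcorner B_1$ converges to $\tau$ weakly-$*$ in $\mathcal{M}(\overline{B_1})$. For a linear subspace $V\subset\mathbb{R}^d$, a measure $\mu\in\mathcal{M}(\mathbb{R}^d)$ is $V$-invariant if $t_\#\mu=\mu$ for every translation $t:\mathbb{R}^d\to\mathbb{R}^d$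 with $t(V)=V$ (i.e. translation by a vector of $V$). With $\mathcal{H}^\kappa$ the $\kappa$-dimensional Hausdorff measure on $\mathbb{R}^d$, $\dim_{\mathcal H}(\sigma):=\sup\{0\le\kappa\le d : \sigma\ll\mathcal{H}^\kappa\}$. *)

(* Defs.v *)
From HB Require Import structures.
From mathcomp Require Import all_boot all_order all_algebra.
From mathcomp Require Import all_classical all_reals all_analysis.

Set Implicit Arguments.
Unset Strict Implicit.
Unset Printing Implicit Defensive.
Import Order.TTheory GRing.Theory Num.Theory.
Import numFieldNormedType.Exports.

Local Open Scope classical_set_scope.
Local Open Scope ring_scope.

(* R^d with its Borel sigma-algebra. The topology on row vectors is the
   product topology (their library norm is the sup norm, hence [enorm]). *)
Notation borelRd R d := (g_sigma_algebraType (@open 'rV[R]_d)).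

Section euclidean.
Context {R : realType} {d : nat}.
Implicit Types (x y : 'rV[R]_d) (r : R) (A : set 'rV[R]_d).

Definition enorm x : R := Num.sqrt (\sum_(i < d) x 0 i ^+ 2).

Definition eball x r : set 'rV[R]_d := [set y | enorm (y - x) < r].

Definition eclosed_ball x r : set 'rV[R]_d := [set y | enorm (y - x) <= r].

(* -oo on the empty set *)
Definition ediam A : \bar R :=
  ereal_sup [set (enorm (x - y))%:E | x in A & y in A].

End euclidean.

Section lebesgue_and_hausdorff.
Context {R : realType} {d : nat}.
Implicit Types (a b : 'rV[R]_d) (A : set (borelRd R d)).
Local Open Scope ereal_scope.

Definition box a b : set 'rV[R]_d :=
  [set x | forall i, (a 0%R i < x 0%R i <= b 0%R i)%R].

Definition box_volume a b : R := (\prod_(i < d) Num.max 0 (b 0 i - a 0 i))%R.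

(* Coverings below are countable families indexed by a subset P of nat, so
   that finite and empty coverings are allowed. *)
Definition lebesgueRd A : \bar R :=
  ereal_inf [set s | exists (P : pred nat) (a b : nat -> 'rV[R]_d),
    A `<=` \bigcup_(j in [set j | P j]) box (a j) (b j) /\
    s = \sum_(0 <= j <oo | P j) (box_volume (a j) (b j))%:E].

Definition hausdorff_premeasure (kappa delta : R) A : \bar R :=
  ereal_inf [set s | exists (P : pred nat) (E : nat -> set 'rV[R]_d),
    [/\ A `<=` \bigcup_(j in [set j | P j]) E j,
        forall j, P j -> E j !=set0 /\ ediam (E j) <= delta%:E &
        s = \sum_(0 <= j <oo | P j) (ediam (E j) `^ kappa)]].

(* No normalising constant in front of diam^kappa: only the null sets of the
   Hausdorff measures matter here. Since 0 `^ 0 = 1, kappa = 0 gives the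
   counting measure. *)
Definition hausdorff_measure (kappa : R) A : \bar R :=
  ereal_sup [set hausdorff_premeasure kappa delta A
            | delta in [set delta : R | (0 < delta)%R]].

Definition hausdorff_dim (mu : set (borelRd R d) -> \bar R) : \bar R :=
  ereal_sup [set kappa%:E | kappa in
    [set kappa : R | (0 <= kappa <= d%:R)%R /\ mu `<< hausdorff_measure kappa]].

(* Determines mu_a and mu_s uniquely; they exist when mu is sigma-finite. *)
Definition lebesgue_decomposition
    (mu mu_a mu_s : {measure set (borelRd R d) -> \bar R}) : Prop :=
  [/\ forall A, measurable A -> mu A = mu_a A + mu_s A,
      mu_a `<< lebesgueRd &
      exists N, [/\ measurable N, lebesgueRd N = 0 & mu_s (~` N) = 0]].

End lebesgue_and_hausdorff.

Section radon.
Context {R : realType} {d : nat}.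

(* Positive Radon measures on a Borel set X (below: an open set, a closed ball
   or the whole space), extended by 0 to R^d; no bound is imposed on the mass
   near the points of the boundary that are not in X. On such X, finiteness on
   compact sets implies Borel regularity. *)
Definition radon_on (X : set 'rV[R]_d)
    (mu : {measure set (borelRd R d) -> \bar R}) : Prop :=
  (mu (~` X) = 0)%E /\
  forall K : set 'rV[R]_d, compact K -> K `<=` X -> (mu K < +oo)%E.

(* Real-valued Radon measures on X, written as a difference of two positive
   ones (Jordan decomposition; the two parts need not be mutually singular).
   Such a measure has well-defined values on the Borel sets that are included
   in a compact subset of X only. *)
Record real_radon (X : set 'rV[R]_d) := RealRadon {
  rr_pos : {measure set (borelRd R d) -> \bar R};
  rr_neg : {measure set (borelRd R d) -> \bar R};
  rr_posP : radon_on X rr_pos;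
  rr_negP : radon_on X rr_neg }.

Definition rr_val X (mu : real_radon X) (A : set (borelRd R d)) : R :=
  fine (rr_pos mu A) - fine (rr_neg mu A).

Definition rr_integral X (mu : real_radon X) (phi : 'rV[R]_d -> R) : R :=
  \int[rr_pos mu]_(x in X) phi x - \int[rr_neg mu]_(x in X) phi x.

Definition invariant_radon (V : {vspace 'rV[R]_d}) (mu : real_radon setT) :=
  forall v, v \in V -> forall A K : set 'rV[R]_d,
    measurable (A : set (borelRd R d)) -> compact K -> A `<=` K ->
    rr_val mu ((fun y : 'rV[R]_d => y + v) @^-1` A) = rr_val mu A.

Definition rescale (x : 'rV[R]_d) (r : R) : borelRd R d -> borelRd R d :=
  fun y : 'rV[R]_d => r^-1 *: (y - x).

Lemma open_eball (x : 'rV[R]_d) (r : R) : open (eball x r).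
Proof.
have coord_cont (i : 'I_d) :
    continuous (fun y : 'rV[R]_d => (y - x) 0 i ^+ 2).
  move=> y; rewrite (_ : (fun _ => _) =
      (fun z : 'rV[R]_d => (z 0 i - x 0 i) ^+ 2)); last first.
    by apply/funext => z; rewrite !mxE.
  apply: (@continuous_comp _ _ _ (fun z : 'rV[R]_d => z 0 i - x 0 i)
    (fun z => z ^+ 2)); last exact: exprn_continuous.
  by apply: continuousB; [exact: coord_continuous|exact: cst_continuous].
have enorm_cont : continuous (fun y : 'rV[R]_d => enorm (y - x)).
  move=> y; apply: (@continuous_comp _ _ _ (fun y : 'rV[R]_d =>
    \sum_(i < d) (y - x) 0 i ^+ 2) Num.sqrt); last exact: sqrt_continuous.
  by apply: continuous_big => //; exact: add_continuous.
by move/continuousP : enorm_cont => /(_ _ (@open_lt R r)).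
Qed.

Lemma measurable_eball (x : 'rV[R]_d) (r : R) :
  measurable (eball x r : set (borelRd R d)).
Proof. by apply: sub_sigma_algebra; exact: open_eball. Qed.

Lemma measurable_rescale (x : 'rV[R]_d) (r : R) :
  measurable_fun setT (rescale x r).
Proof.
have rescale_cont : continuous (fun y : 'rV[R]_d => r^-1 *: (y - x)).
  move=> y; apply: (@continuous_comp _ _ _ (fun y : 'rV[R]_d => y - x)
    (fun y => r^-1 *: y)); last exact: scaler_continuous.
  by apply: continuousB; [exact: cvg_id|exact: cst_continuous].
apply: (@measurability _ _ (borelRd R d) (borelRd R d) _ _
  (@open 'rV[R]_d)) => //.
move=> _ [B oB <-]; rewrite setTI; apply: sub_sigma_algebra.
by move/continuousP : rescale_cont; exact.
Qed.

Section blowup.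
Variables (mu : {measure set (borelRd R d) -> \bar R}) (x : 'rV[R]_d) (r : R).

Lemma blowup_factor_ge0 : 0 <= (fine (mu (eball x r)))^-1.
Proof. by rewrite invr_ge0 fine_ge0. Qed.

(* mu is positive, so that |mu| = mu. *)
Definition blowup (A : set (borelRd R d)) : \bar R :=
  (((fine (mu (eball x r)))^-1)%:E *
   pushforward mu (rescale x r) (A `&` eball 0 1))%E.

Let push : {measure set (borelRd R d) -> \bar R} :=
  measure_function_pushforward__canonical__measure_function_Measure mu
    (measurable_rescale x r).

Let blowup_aux : {measure set (borelRd R d) -> \bar R} :=
  mscale (NngNum blowup_factor_ge0) (mrestr push (measurable_eball 0 1)).

Let blowup0 : blowup set0 = 0%E.
Proof. exact: (measure0 blowup_aux). Qed.

Let blowup_ge0 A : (0 <= blowup A)%E.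
Proof. exact: (measure_ge0 blowup_aux). Qed.

Let blowup_sigma_additive : semi_sigma_additive blowup.
Proof. exact: (@measure_semi_sigma_additive _ _ _ blowup_aux). Qed.

HB.instance Definition _ := isMeasure.Build _ _ _ blowup
  blowup0 blowup_ge0 blowup_sigma_additive.

End blowup.

(* The bounds on mu (eball x (r j)) make the normalisation in [blowup]
   meaningful. The upper one can fail for large r j, since a Radon measure on
   an open set need not be finite on the balls that meet its complement. *)
Definition tangent_measure (mu : {measure set (borelRd R d) -> \bar R})
    (x : 'rV[R]_d) (tau : real_radon (eclosed_ball 0 1)) : Prop :=
  exists r : nat -> R,
    [/\ forall j, 0 < r j, nonincreasing_seq r, r @ \oo --> 0,
        forall j, (0 < mu (eball x (r j)) < +oo)%E &
        forall phi : 'rV[R]_d -> R,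
          {within eclosed_ball 0 1, continuous phi} ->
          \int[blowup mu x (r j)]_(y in eclosed_ball 0 1) phi y @[j --> \oo]
            --> rr_integral tau phi].

End radon.

(* Main.v *)
Require Import Defs.
From HB Require Import structures.
From mathcomp Require Import all_boot all_order all_algebra.
From mathcomp Require Import all_classical all_reals all_analysis.
From mathcomp Require Import finmap measurable_realfun.
From mathcomp Require Import zify ring lra.

(** Fix 0 < kappa < l; it is enough that sigma vanishes on the sets that are
null for the kappa-dimensional Hausdorff measure. The absolutely continuous
part does, because kappa <= d ([hausdorff_null_lebesgue]). For the singular
part, which is called mu here, the point is that at almost every x

   mu (B (x, 2^-k)) = O (2^(- kappa k))   as k tends to infinity,

for a Hausdorff null set whose points all have this property can be covered by
dyadic balls centred on it with a total mass that is as small as one wishes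
([growth_negligible]).

Suppose that the growth bound fails at a point x where the tangent measures
split. Then 2^(kappa k) mu (B (x, 2^-k)) is unbounded in k and is multiplied by
at most 2^kappa from one scale to the next. This forces arbitrarily long windows
of consecutive scales along which it does not fall below its value at the largest
scale of the window ([submultiplicative_window]). Blowing mu up at the beginnings of
longer and longer windows and passing to a weak-* limit gives a tangent measure
tau such that tau (B (0, 2^-i)) >= 2^(- kappa (i + 1)) for all i
([tangent_lower_bound]). On the other hand, for a measure t that is invariant
under V, the unit scale contains about r^(- dim V) disjoint translates of
B (0, r) by vectors of V, and t takes the same value on all of them, so that
t (B (0, r)) = O (r^(dim V)); this holds for real-valued t as well, with the
total mass of t near the origin as the constant ([invariant_radon_ball]).
Summing over the components of tau gives tau (B (0, r)) = O (r^l), which is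
incompatible with the lower bound since kappa < l ([split_tangent_growth]).

The weak-* limit is constructed directly ([weak_star_compactness]). A compact
space is cut into finer and finer finite partitions, the cells of which are
numbered compatibly. Along a subsequence the masses of all the cells converge;
the limits, cumulated in the order of the numbering, are the values of a
distribution function, and the corresponding quantile map sends Lebesgue measure
on [0, 1[ to the limit measure. *)

Set Implicit Arguments.
Unset Strict Implicit.
Unset Printing Implicit Defensive.
Import Order.TTheory GRing.Theory Num.Theory.
Import numFieldNormedType.Exports.

Local Open Scope classical_set_scope.
Local Open Scope ring_scope.

(** * Binary codes of the points of a compact space *)

Section code.
Context {T : Type}.
Variable B : nat -> set T.

(** The binary digits of [code n x] tell which of the first n sets B contain x.
The digit of the last set is the lowest one, hence the cells of level n + 1
split those of level n into consecutive pairs: cumulating masses in the order of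
the codes is compatible with refining the partition. *)
Fixpoint code n x : nat :=
  if n is m.+1 then ((x \in B m) + (code m x).*2)%N else 0%N.

Lemma code_lt n x : (code n x < 2 ^ n)%N.
Proof. by elim: n => //= n ih; rewrite expnS; case: (x \in B n); lia. Qed.

Lemma half_code n x : (code n.+1 x)./2 = code n x.
Proof. by rewrite /= half_bit_double. Qed.

Lemma code_eq_le m n x y : (m <= n)%N -> code n x = code n y ->
  code m x = code m y.
Proof.
move=> /subnK <-; elim: (n - m)%N => // k ih; rewrite addSn => /(congr1 half).
by rewrite !half_code.
Qed.

Lemma code_mem m n x y : (m < n)%N -> code n x = code n y -> B m x -> B m y.
Proof.
move=> mn /(code_eq_le mn) /(congr1 odd) /=.
rewrite !oddD !odd_double !addbF !oddb => xy /mem_set; rewrite xy.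
by move/set_mem.
Qed.

End code.

Lemma measurable_code d (T : measurableType d) (B : nat -> set T) n i :
  (forall m, measurable (B m)) -> measurable [set x | code B n x = i].
Proof.
move=> mB; elim: n i => [|n ih] i.
  by have [->|i0] := eqVneq i 0%N; [rewrite (_ : mkset _ = setT)|
     rewrite (_ : mkset _ = set0)] => //; apply/seteqP; split => x //=;
     [move=> i0'; rewrite i0' eqxx in i0].
rewrite (_ : mkset _ = [set x | code B n x = i./2] `&`
   (if odd i then B n else ~` B n)); last first.
  apply/seteqP; split => x /=.
  - move=> <-; rewrite half_bit_double oddD odd_double addbF oddb; split=> //.
    by case: ifPn => [/set_mem//|/negP xB xB']; exact/xB/mem_set.
  - move=> [->]; case: ifPn => oi xB; rewrite ?(mem_set xB) ?(memNset xB);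
      rewrite -[RHS]odd_double_half ?oi ?(negbTE oi) //.
by apply: measurableI => //; case: ifP => _ //; exact: measurableC.
Qed.

Notation borel T := (g_sigma_algebraType (@open T)).

(** For the sets B take, for each k, a finite cover by balls of radius (k+1)^-1:
two points with the same code at a level that exceeds the indices of the k-th
cover lie in a common ball of that cover. *)
Lemma compact_code {R : realType} {T : pseudoMetricNormedZmodType R}
    (X : set T) :
  compact X -> exists B : nat -> set T, (forall m, open (B m)) /\
  forall e : R, 0 < e -> exists n, forall x y, X x -> X y ->
    code B n x = code B n y -> ball x e y.
Proof.
move=> cX.
have /choice[F FX] (k : nat) : exists s : seq T, forall x, X x ->
    exists2 i, (i < size s)%N & (ball (nth point s i) k.+1%:R^-1)° x.
  have := cX; rewrite compact_cover.
  move=> /(_ _ X (fun c : T => (ball c (k.+1%:R^-1 : R))°)).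
  case=> [c Xc|x Xx|D _ XD]; first exact: open_interior.
    by exists x => //; apply: nbhsx_ballx; rewrite invr_gt0.
  exists (enum_fset D) => x /XD[c /= cD xc].
  exists (index c (enum_fset D)); first by rewrite index_mem.
  by rewrite nth_index.
exists (fun m : nat => if (choice.unpickle m : option (nat * nat)) is Some (k, i)
  then (ball (nth point (F k) i) (k.+1%:R^-1 : R))° else set0).
split=> [m|e e0].
  by case: (choice.unpickle m : option (nat * nat)) => [[k i]|];
    [exact: open_interior|exact: open0].
have [//|k] := @ltr_add_invr R 0 (e / 2) _; first by rewrite divr_gt0.
rewrite add0r => ke.
exists (\max_(i < size (F k)) choice.pickle (k, i : nat)).+1 => x y Xx Xy xy.
have [i ik xi] := FX k _ Xx.
have lei : (choice.pickle (k, i) < (\max_(i < size (F k))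
  choice.pickle (k, i : nat)).+1)%N.
  by rewrite ltnS; exact: (leq_bigmax (Ordinal ik)).
have := code_mem lei xy; rewrite choice.pickleK => /(_ xi) yi.
rewrite [e]splitr; apply: (@ball_triangle _ _ (nth point (F k) i)).
- by apply: ball_sym; apply: (le_ball (ltW ke)); exact: interior_subset.
- by apply: (le_ball (ltW ke)); exact: interior_subset.
Qed.

(** Heine's theorem, for functions that are continuous on X only. *)
Lemma compact_unif_cont {R : realType} {T : pseudoMetricNormedZmodType R}
    (X : set T)
    (f : T -> R) : compact X -> {within X, continuous f} ->
  forall e : R, 0 < e -> exists2 r : R, 0 < r & forall x y, X x -> X y ->
    ball x r y -> `|f x - f y| < e.
Proof.
move=> /compact_near_coveringP/near_covering_withinP cX cf e e0.
have := cX _ (0 : R)^'+ (fun r x => forall y, X y -> ball x r y ->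
   `|f x - f y| < e).
case.
  move=> x Xx.
  move/subspace_continuousP : cf => /(_ x Xx).
  move=> /cvgrPdist_lt/(_ (e / 2)); rewrite divr_gt0// => /(_ isT).
  rewrite near_withinE => /nbhs_ballP[r /= r0 rf].
  near=> x' r'.
  have xx' : ball x (r / 2) x'.
    by near: x'; apply: nbhsx_ballx; rewrite divr_gt0.
  have r'r : r' <= r / 2 by near: r'; apply: nbhs_right_le; rewrite divr_gt0.
  move=> Xx' y Xy xy.
  have fx' : `|f x - f x'| < e / 2.
    apply: rf => //; apply: (@le_ball _ _ x (r / 2)); first by lra.
    exact: xx'.
  have fy : `|f x - f y| < e / 2.
    apply: rf => //; rewrite [r]splitr; apply: (@ball_triangle _ _ x') => //.
    exact: le_ball xy.
  rewrite (_ : f x' - f y = (f x - f y) - (f x - f x')); last by ring.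
  by rewrite [e]splitr (le_lt_trans (ler_normB _ _))// ltrD.
move=> r /= r0 h; exists (r / 2); first by rewrite divr_gt0.
move=> x y Xx Xy xy; apply: (h (r / 2)) => //=; last by rewrite divr_gt0.
by rewrite sub0r normrN gtr0_norm ?divr_gt0//; lra.
Unshelve. all: by end_near. Qed.

(** * Weak-* sequential compactness of the probabilities on a compact space *)

Lemma integrable_step d (S : measurableType d) (R : realType)
    (mu : {measure set S -> \bar R}) (A : set S) (c : S -> nat) (N : nat)
    (a : nat -> R) (f : S -> R) (e : R) :
  measurable A -> (mu A < +oo)%E ->
  measurable_fun A f -> (forall x, A x -> (c x < N)%N) ->
  (forall x, A x -> `|f x - a (c x)| <= e) -> mu.-integrable A (EFin \o f).
Proof.
move=> mA muA mf cN fa; apply: measurable_bounded_integrable => //.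
exists (e + \sum_(i < N) `|a i|); split; first by rewrite num_real.
move=> M aM x Ax /=; apply/ltW/le_lt_trans/aM.
rewrite -[f x](subrK (a (c x))) (le_trans (ler_normD _ _))// lerD ?fa//.
by rewrite (bigD1 (Ordinal (cN _ Ax)))//= lerDl sumr_ge0.
Qed.

Lemma Rintegral_step d (S : measurableType d) (R : realType)
    (mu : {measure set S -> \bar R}) (A : set S) (c : S -> nat) (N : nat)
    (a : nat -> R) (f : S -> R) (e : R) :
  measurable A -> (mu A < +oo)%E ->
  (forall i, measurable [set x | c x = i]) ->
  measurable_fun A f -> (forall x, A x -> (c x < N)%N) ->
  (forall x, A x -> `|f x - a (c x)| <= e) ->
  `|\int[mu]_(x in A) f x -
    \sum_(i < N) a i * fine (mu ([set x | c x = i] `&` A))| <= e * fine (mu A).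
Proof.
move=> mA muA mc mf cN fa.
pose g x : R := \sum_(i < N) a i * \1_[set x | c x = i] x.
have gE x : A x -> g x = a (c x).
  move=> Ax; rewrite /g (bigD1 (Ordinal (cN _ Ax)))//= big1 ?addr0.
    by rewrite indicE mem_set ?mulr1.
  move=> i; rewrite -val_eqE/= => ic.
  by rewrite indicE memNset ?mulr0//= => ci; rewrite ci eqxx in ic.
have int1 (i : nat) : mu.-integrable A (EFin \o (fun x => a i * \1_[set x | c x = i] x)).
  apply: measurable_bounded_integrable => //.
    apply: measurable_funM => //.
  exists `|a i|; split; first by rewrite num_real.
  move=> M aM x _ /=; rewrite normrM; apply/ltW/le_lt_trans/aM.
  by rewrite indicE; case: (_ \in _); rewrite /= ?normr1 ?normr0 ?mulr1 ?mulr0.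
have intg : mu.-integrable A (EFin \o g).
  rewrite (_ : _ \o _ = fun x => (\sum_(i < N) (a i * \1_[set x | c x = i] x)%:E)%E).
    by apply: integrable_sum => // i _; exact: int1.
  by apply/funext => x /=; rewrite sumEFin.
have intf := integrable_step mA muA mf cN fa.
have -> : \sum_(i < N) a i * fine (mu ([set x | c x = i] `&` A)) =
    \int[mu]_(x in A) g x.
  rewrite /Rintegral /g; under [in RHS]eq_integral do rewrite -sumEFin.
  rewrite integral_sum//; last by move=> i; exact: int1.
  rewrite (eq_bigr (fun i : 'I_N => (a i * fine (mu ([set x | c x = i] `&` A)))%:E)).
    by rewrite sumEFin.
  move=> i _; under eq_integral do rewrite EFinM.
  rewrite integralZl//.
    rewrite integral_indic// EFinM fineK// ge0_fin_numE//.
    by apply: le_lt_trans muA; apply: le_measure; [apply/mem_set;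
      apply: measurableI => //; exact: mc|exact/mem_set|exact: subIsetr].
  apply: measurable_bounded_integrable => //.
  exists 1; split; first by rewrite num_real.
  move=> M aM x _ /=; apply/ltW/le_lt_trans/aM.
  by rewrite indicE; case: (_ \in _); rewrite /= ?normr1 ?normr0.
rewrite -(RintegralB mA intf intg) (le_trans (le_normr_Rintegral _ _))//.
  by have := integrableB mA intf intg; apply: eq_integrable.
rewrite -Rintegral_cst//; apply: le_Rintegral => //.
- have := integrable_norm (integrableB mA intf intg).
  exact.
- by apply: measurable_bounded_integrable => //; exact: bounded_cst.
- by move=> x Ax; rewrite gE// fa.
Qed.

Lemma nbhs_prod_forall (R : realType)
    (G : prod_topology (fun _ : nat => R)) k (e : R) :
  0 < e -> nbhs G [set g : prod_topology (fun _ : nat => R) |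
    forall m, (m < k)%N -> `|G m - g m| < e].
Proof.
move=> e0; elim: k => [|k ih].
  rewrite (_ : mkset _ = setT); first exact: filterT.
  by apply/seteqP; split.
have h : nbhs G [set g | `|G k - g k| < e].
  exact: (@proj_continuous nat (fun _ => R) k G (ball (G k) e)
    (nbhsx_ballx (G k) e e0)).
apply: filterS (filterI ih h) => g [ih' h'] m.
by rewrite ltnS leq_eqVlt => /predU1P[->//|]; exact: ih'.
Qed.

(** By Tychonoff's theorem the sequence [F] has a cluster point in the Hilbert
cube; the subsequence picks, at step j, a term that is close to it on the first
j coordinates. *)
Lemma diagonal_subsequence (R : realType) (F : nat -> nat -> R) :
  (forall j m, 0 <= F j m <= 1) -> exists (s : nat -> nat) (G : nat -> R),
    (forall j, (s j < s j.+1)%N) /\ forall m, F (s j) m @[j --> \oo] --> G m.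
Proof.
move=> F01.
have cK := @tychonoff nat (fun _ => R) (fun _ => `[0, 1]%classic)
  (fun _ => @segment_compact R 0 1).
have [|G [_ clG]] := cK (F @ \oo) _.
  by exists 0%N => // j _ m /=; rewrite in_itv/=; exact: F01.
pose A n : set (nat -> R) := [set g | forall m, (m < n)%N -> `|G m - g m| < n.+1%:R^-1].
have nA n : nbhs (G : prod_topology (fun _ : nat => R)) (A n).
  by apply: nbhs_prod_forall; rewrite invr_gt0.
have /choice[f hf] (p : nat * nat) : exists j, (p.2 <= j)%N /\ A p.1 (F j).
  have := clG [set g | exists2 j, (p.2 <= j)%N & g = F j] (A p.1).
  case=> //; first by exists p.2 => // j /= pj; exists j.
  by move=> g [[j pj ->] Aj]; exists j.
pose s := fix s n := if n is m.+1 then f (n, (s m).+1) else f (0%N, 0%N).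
exists s, G; split=> [j|m]; first by have [] := hf (j.+1, (s j).+1).
have sA j : A j (F (s j)).
  by case: j => [|j]; [have [] := hf (0%N, 0%N)|have [] := hf (j.+1, (s j).+1)].
apply/cvgrPdist_lt => e e0.
have [//|n] := @ltr_add_invr R 0 e _; rewrite add0r => ne.
near=> j; apply: lt_trans ne.
have nj : (maxn n m < j)%N by near: j; exists (maxn n m).+1.
apply: lt_le_trans (sA j m _) _; first by lia.
by rewrite lef_pV2 ?posrE// ler_nat; lia.
Unshelve. all: by end_near. Qed.

(** [G n] is the distribution function of a probability on the 2^n cells of
level n, and [q n u] is the cell that contains the quantile of order u. The
quantile cells of successive levels are nested because the [G n] refine each
other. *)
Lemma quantile_index (R : realType) (G : nat -> nat -> R) :
  (forall n, G n 0%N = 0) -> (forall n, G n (2 ^ n)%N = 1) ->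
  (forall n i, (i < 2 ^ n)%N -> G n i <= G n i.+1) ->
  (forall n i, (i <= 2 ^ n)%N -> G n.+1 i.*2 = G n i) ->
  exists q : nat -> R -> nat, forall n u, 0 <= u < 1 ->
   [/\ forall i, (i < 2 ^ n)%N -> (q n u = i <-> G n i <= u < G n i.+1),
     (q n u < 2 ^ n)%N & (q n.+1 u)./2 = q n u].
Proof.
move=> G0 G1 Gle Ghalf.
have mono n i j : (i <= j)%N -> (j <= 2 ^ n)%N -> G n i <= G n j.
  move=> /subnK <-; elim: (j - i)%N => // k ih; rewrite addSn => kn.
  by apply: le_trans (ih (ltnW kn)) (Gle _ _ kn).
have ex n u : 0 <= u < 1 -> exists2 i, (i < 2 ^ n)%N & G n i <= u < G n i.+1.
  move=> /andP[u0 u1].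
  have : forall k, (k <= 2 ^ n)%N -> u < G n k ->
    exists2 i, (i < k)%N & G n i <= u < G n i.+1.
    elim=> [|k ih] kn; first by rewrite G0 ltNge u0.
    move=> uk; have [ku|ku] := leP (G n k) u; first by exists k; rewrite // ku.
    by have [i ik iu] := ih (ltnW kn) ku; exists i => //; rewrite ltnS ltnW.
  by move=> /(_ _ (leqnn _)); rewrite G1; exact.
have uniq n u i j : (i < 2 ^ n)%N -> (j < 2 ^ n)%N -> G n i <= u < G n i.+1 ->
    G n j <= u < G n j.+1 -> i = j.
  wlog : i j / (i <= j)%N => [h im jn iu ju|ij im jn /andP[_ iu] /andP[ju _]].
    by case/orP : (leq_total i j) => ij; [exact: h|apply/esym; exact: h].
  apply/eqP; rewrite eqn_leq ij leqNgt; apply/negP => ij'.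
  by move: (le_lt_trans (le_trans (mono _ _ _ ij' (ltnW jn)) ju) iu); rewrite ltxx.
have /choice[q hq] (p : nat * R) : exists i, 0 <= p.2 < 1 ->
    (i < 2 ^ p.1)%N /\ G p.1 i <= p.2 < G p.1 i.+1.
  have [/ex-/(_ p.1)[i]|] := pselect (0 <= p.2 < 1); first by exists i.
  by exists 0%N.
exists (fun n u => q (n, u)) => n u u01; have [qn qu] := hq (n, u) u01.
split => // [i im|]; first by split => [<-//|iu]; exact: (uniq n u).
have [] := hq (n.+1, u) u01.
rewrite [(n.+1, u).1]/= [(n.+1, u).2]/=; move: (q (n.+1, u)) => k kn /andP[ku uk].
have hn : (k./2 < 2 ^ n)%N by rewrite ltn_half_double -mul2n -expnS.
apply: (uniq n u) => //.
rewrite -[G n _]Ghalf ?(ltnW hn)// -[G n _.+1]Ghalf//.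
apply/andP; split.
  by apply: le_trans ku; apply: mono; [lia|exact: ltnW].
apply: (lt_le_trans uk); apply: mono; first by lia.
by rewrite expnS mul2n leq_double.
Qed.

Lemma within_continuous_measurable (R : realType) (T : pseudoMetricNormedZmodType R)
    (X : set T) (f : T -> R) : closed X -> {within X, continuous f} ->
  measurable_fun (X : set (borel T)) f.
Proof.
move=> clX /continuousP cf; apply: (measurability _ (RGenOpens.measurableE R)).
move=> _ [_ [a [b ->] <-]].
have : open (f @^-1` `]a, b[ : set (subspace X)) by exact/cf/interval_open.
move=> /open_subspaceP[U oU UX].
rewrite setIC -UX; apply: measurableI; first exact: sub_sigma_algebra.
rewrite -[X]setCK; apply: measurableC; apply: sub_sigma_algebra.
exact: closed_openC.
Qed.

(** The measure [tau] is the image of Lebesgue measure on [0, 1[ under the map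
[t] that sends u to the point determined by its nested quantile cells. Both
integrals in the conclusion are compared with Riemann sums over the cells of a
fine level, whose weights for [nu (s j)] converge to those for [tau]. The errors
are small uniformly in j: for [nu (s j)] because phi varies little on a cell,
and for [tau] because [t u] is close to the cell of u. *)
Lemma weak_star_compactness (R : realType) (T : pseudoMetricNormedZmodType R) (X : set T)
    (nu : nat -> {measure set (borel T) -> \bar R}) :
  compact X -> closed X -> (forall j, nu j X = 1%E) ->
  exists (s : nat -> nat) (tau : {measure set (borel T) -> \bar R}),
    [/\ forall j, (s j < s j.+1)%N, tau (~` X) = 0%E, tau X = 1%E &
      forall phi : T -> R, {within X, continuous phi} ->
        \int[nu (s j)]_(x in X) phi x @[j --> \oo] --> \int[tau]_(x in X) phi x].
Proof.
move=> cX clX nuX.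
have [B [oB hB]] := compact_code cX.
have mB m : measurable (B m : set (borel T)) by exact: sub_sigma_algebra.
have mX : measurable (X : set (borel T)).
  by rewrite -[X]setCK; apply: measurableC; apply: sub_sigma_algebra;
    exact: closed_openC.
have mcell n i : measurable ([set x | code B n x = i] : set (borel T)).
  exact: measurable_code.
have mlt n i : measurable ([set x | (code B n x < i)%N] : set (borel T)).
  rewrite (_ : mkset _ = \bigcup_(k in [set k | (k < i)%N]) [set x | code B n x = k]).
    by apply: bigcup_measurable => k _; exact: mcell.
  apply/seteqP; split => [x /= xi|x [k /= ki xk]]; last by rewrite xk.
  by exists (code B n x).
(* the distribution function of nu j at level n *)
pose F j n i : R := fine (nu j ([set x | (code B n x < i)%N] `&` X)).
have nufin j (A : set (borel T)) : measurable A ->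
    nu j (A `&` X) \is a fin_num /\ (nu j (A `&` X) <= 1)%E.
  move=> mA.
  have le1 : (nu j (A `&` X) <= 1)%E.
    rewrite -(nuX j); apply: le_measure; [apply/mem_set|exact/mem_set|].
      exact: measurableI.
    exact: subIsetr.
  split => //; rewrite ge0_fin_numE ?measure_ge0//.
  by apply: le_lt_trans le1 _; exact: ltry.
have F01 j n i : 0 <= F j n i <= 1.
  have [f1 l1] := nufin j _ (mlt n i).
  by rewrite fine_ge0 ?measure_ge0//= -lee_fin fineK.
have [s [G' [hs hG']]] : exists (s : nat -> nat) (G : nat -> R),
    (forall j, (s j < s j.+1)%N) /\ forall m,
      (if (choice.unpickle m : option (nat * nat)) is Some (n, i) then F (s j) n i
       else 0) @[j --> \oo] --> G m.
  apply: (diagonal_subsequence (F := fun j m =>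
    if (choice.unpickle m : option (nat * nat)) is Some (n, i) then F j n i
    else 0)) => j m.
  by case: (choice.unpickle m : option (nat * nat)) => [[n i]|] //=;
    rewrite lexx ler01.
pose G (n i : nat) : R := G' (choice.pickle (n, i)).
have hG n i : F (s j) n i @[j --> \oo] --> G n i.
  by have := hG' (choice.pickle (n, i)); rewrite choice.pickleK.
have G0 n : G n 0%N = 0.
  apply: (cvg_unique _ (hG n 0%N)) => //.
  rewrite (_ : (fun j => _) = fun=> 0); first exact: cvg_cst.
  apply/funext => j; rewrite /F (_ : mkset _ = set0) ?set0I ?measure0//.
  by apply/seteqP; split.
have G1 n : G n (2 ^ n)%N = 1.
  apply: (cvg_unique _ (hG n (2 ^ n)%N)) => //.
  rewrite (_ : (fun j => _) = fun=> 1); first exact: cvg_cst.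
  apply/funext => j; rewrite /F (_ : mkset _ = setT) ?setTI ?nuX//.
  by apply/seteqP; split => // x _ /=; exact: code_lt.
have FS j n i : F j n i.+1 = F j n i + fine (nu j ([set x | code B n x = i] `&` X)).
  rewrite /F -fineD ?(nufin _ _ _).1//.
  rewrite -measureU; first last.
  - by apply/seteqP; split => // x [[/= xi _] [xi' _]]; rewrite xi' ltnn in xi.
  - by apply: measurableI => //; exact: mcell.
  - by apply: measurableI => //; exact: mlt.
  rewrite -setIUl; congr (fine (nu j (_ `&` _))).
  apply/seteqP; split => x /=.
    by rewrite ltnS leq_eqVlt => /predU1P[]; [right|left].
  by move=> [xi|->]; [exact: ltnW|].
have Gle n i : (i < 2 ^ n)%N -> G n i <= G n i.+1.
  move=> _; apply: (ler_cvg_to (hG n i) (hG n i.+1)).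
  by apply: nearW => j; rewrite FS lerDl fine_ge0 ?measure_ge0.
have Ghalf n i : (i <= 2 ^ n)%N -> G n.+1 i.*2 = G n i.
  move=> _; apply: (cvg_unique _ (hG n.+1 i.*2)) => //.
  rewrite (_ : (fun j => _) = (fun j => F (s j) n i)); first exact: hG.
  apply/funext => j; congr (fine (nu _ (_ `&` _))).
  by apply/seteqP; split => x /=; rewrite -ltn_half_double half_bit_double.
have [q hq] := quantile_index G0 G1 Gle Ghalf.
pose D : set (measurableTypeR R) := [set` `[0, 1[%R].
have mD : measurable D by exact: measurable_itv.
(* The quantile of order u is used for 0 <= u < 1 only; sending the other u to 0
   makes the properties of the quantile cells hold for all u. *)
pose clip u : R := u * \1_D u.
have clip01 u : 0 <= clip u < 1.
  rewrite /clip indicE; have [Du|Du] := pselect (D u).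
    by rewrite mem_set// mulr1; move: Du; rewrite /D/= in_itv.
  by rewrite memNset// mulr0 lexx ltr01.
have clipD u : D u -> clip u = u by move=> Du; rewrite /clip indicE mem_set ?mulr1.
have mclip : measurable_fun [set: measurableTypeR R] (clip : measurableTypeR R -> R).
  by apply: measurable_funM => //; exact: measurable_indic.
pose c n (u : measurableTypeR R) : nat := q n (clip u).
have clt n u : (c n u < 2 ^ n)%N by have [] := hq n _ (clip01 u).
have chalf n u : (c n.+1 u)./2 = c n u by have [] := hq n _ (clip01 u).
have cE n u i : (i < 2 ^ n)%N -> c n u = i <-> G n i <= clip u < G n i.+1.
  by move=> iN; have [h _ _] := hq n _ (clip01 u); exact: h.
have mc n i : measurable [set u | c n u = i].
  have [iN|iN] := ltnP i (2 ^ n)%N.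
    rewrite (_ : mkset _ = setT `&` clip @^-1` [set` `[G n i, G n i.+1[%R]).
      by apply: mclip => //; exact: measurable_itv.
    apply/seteqP; split => u; rewrite /= in_itv/=; last by move=> [_ /(cE _ _ _ iN)].
    by move/(cE _ _ _ iN).
  rewrite (_ : mkset _ = set0)//; apply/seteqP; split => u //= cu.
  by move: (clt n u); rewrite cu ltnNge iN.
(* The cell of u meets X: otherwise all nu j would give it mass 0 and G n would
   not jump over u there. *)
have cell_ex n u : exists x, X x /\ code B n x = c n u.
  apply: contrapT => /forallNP no.
  have /(cE _ _ _ (clt n u))/andP[Gu uG] : c n u = c n u by [].
  suff eG : G n (c n u).+1 = G n (c n u).
    by move: (le_lt_trans Gu uG); rewrite eG ltxx.
  apply: (cvg_unique _ (hG n (c n u).+1)) => //.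
  rewrite (_ : (fun j => _) = (fun j => F (s j) n (c n u))); first exact: hG.
  apply/funext => j; rewrite FS (_ : _ `&` _ = set0) ?measure0 ?addr0//.
  by apply/seteqP; split => // x [/= xc Xx]; apply: (no x).
pose pt n i := xget point [set x | X x /\ code B n x = i].
have ptc n u : X (pt n (c n u)) /\ code B n (pt n (c n u)) = c n u.
  exact: (xgetPex point (cell_ex n u)).
have ptx n x : X x -> X (pt n (code B n x)) /\ code B n (pt n (code B n x)) = code B n x.
  by move=> Xx; apply: (@xgetPex _ point [set y | X y /\ code B n y = code B n x]);
    exists x.
have ptle n m u : (n <= m)%N -> code B n (pt m (c m u)) = c n u.
  move=> /subnK; move: (m - n)%N => k; elim: k n => [|k ih] n.
    by rewrite add0n => ->; have [] := ptc m u.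
  by rewrite addSnnS => /ih h; rewrite -half_code h chalf.
(* t u is a cluster point of the points chosen in the nested cells of u. *)
have /choice[t ht] (u : measurableTypeR R) : exists x, X x /\
    cluster ((fun n => pt n (c n u)) @ \oo) x.
  have [|x [Xx clx]] := cX ((fun n => pt n (c n u)) @ \oo) _; last by exists x.
  by exists 0%N => // n _ /=; have [] := ptc n u.
have tX u : X (t u) by have [] := ht u.
have near_pt e : 0 < e -> exists n, forall m u, (n <= m)%N ->
    ball (t u) e (pt m (c m u)).
  move=> e0; have [|n hn] := hB (e / 2); first by rewrite divr_gt0.
  exists n => m u nm; have [_ clu] := ht u.
  have [||y [[k nk ->] tk]] := clu [set y | exists2 k, (n <= k)%N & y = pt k (c k u)]
      (ball (t u) (e / 2)).
  - by exists n => // k /= nk; exists k.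
  - by apply: nbhsx_ballx; rewrite divr_gt0.
  rewrite [e]splitr; apply: ball_triangle tk _.
  apply: hn; [by have [] := ptc k u|by have [] := ptc m u|].
  by rewrite !ptle.
have mt : measurable_fun [set: measurableTypeR R] (t : measurableTypeR R -> borel T).
  have /choice[N hN] (k : nat) : exists n, forall m u, (n <= m)%N ->
      ball (t u) (k.+1%:R^-1 : R) (pt m (c m u)).
    by apply: near_pt; rewrite invr_gt0.
  have mclosed (C : set T) : closed C -> measurable (t @^-1` C).
    move=> clC.
    (* t u is in C if and only if C comes close to the point chosen in the cell
       of u at every level N k; this depends on finitely many cells only. *)
    rewrite (_ : _ @^-1` _ = \bigcap_k \bigcup_(i in
        [set i | exists2 y, C y & ball (pt (N k) i) (k.+1%:R^-1 : R) y])
        [set u | c (N k) u = i]).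
      apply: bigcap_measurable => // k _; apply: bigcup_measurable => i _.
      exact: mc.
    apply/seteqP; split => [u Cu k _|u hu].
      exists (c (N k) u) => //=; exists (t u) => //.
      by apply: ball_sym; apply: hN.
    apply: clC => V /nbhs_ballP[e /= e0 eV].
    have [//|k] := @ltr_add_invr R 0 (e / 2) _; first by rewrite divr_gt0.
    rewrite add0r => ke; have [i [y Cy yi] ui] := hu k Logic.I.
    exists y; split => //; apply: eV; rewrite [e]splitr.
    apply: (ball_triangle (le_ball (ltW ke) (hN k (N k) u _))) => //.
    by apply: (le_ball (ltW ke)); rewrite ui.
  apply: (@measurability _ _ _ (borel T) _ _ (@open T)) => //.
  move=> _ [U oU <-]; rewrite setTI.
  by have := measurableC (mclosed _ (open_closedC oU)); rewrite -preimage_setC setCK.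
pose lam : {measure set (measurableTypeR R) -> \bar R} :=
  mrestr (@lebesgue_measure R) mD.
pose tau : {measure set (borel T) -> \bar R} :=
  measure_function_pushforward__canonical__measure_function_Measure lam mt.
have lamT : lam [set: measurableTypeR R] = 1%E.
  rewrite /lam/= /mrestr setTI /D lebesgue_measure_itv/= lte_fin ltr01.
  by rewrite oppr0 adde0.
have tauE A : tau A = lam (t @^-1` A) by [].
exists s, tau; split => //.
- rewrite tauE (_ : _ @^-1` _ = set0) ?measure0//.
  by apply/seteqP; split => // u /(_ (tX u)).
- rewrite tauE -lamT; congr (lam _).
  by apply/seteqP; split => // u _; exact: tX.
move=> phi cphi.
have mphi : measurable_fun (X : set (borel T)) phi.
  exact: within_continuous_measurable.
have mphi' : measurable_fun [set: borel T] (phi \_ X).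
  by apply/(measurable_restrictT _ mX).
have phit u : (phi \_ X) (t u) = phi (t u) by rewrite patchE mem_set.
have mphit : measurable_fun [set: measurableTypeR R] (phi \o t).
  rewrite (_ : _ \o _ = (phi \_ X) \o t); last by apply/funext => u /=.
  exact: (measurableT_comp mphi' mt).
have approx (e : R) : 0 < e -> exists n : nat,
    [/\ forall x, X x -> `|phi x - phi (pt n (code B n x))| <= e &
     forall u, `|phi (t u) - phi (pt n (c n u))| <= e].
  move=> e0; have [r r0 rphi] := compact_unif_cont cX cphi e0.
  have [n1 hn1] := hB _ r0; have [n2 hn2] := near_pt _ r0.
  exists (maxn n1 n2); split => [x Xx|u].
    have [Xp cp] := ptx (maxn n1 n2) x Xx.
    apply/ltW/rphi => //; apply: hn1 => //; apply: code_eq_le (esym cp).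
    exact: leq_maxl.
  by apply/ltW/rphi => //; [have [] := ptc (maxn n1 n2) u|apply: hn2; exact: leq_maxr].
have inttau e n : (forall u, `|phi (t u) - phi (pt n (c n u))| <= e) ->
    `|\int[tau]_(x in X) phi x -
     \sum_(i < 2 ^ n) phi (pt n i) * (G n i.+1 - G n i)| <= e.
  move=> he.
  have lamoo : (lam [set: measurableTypeR R] < +oo)%E by rewrite lamT ltry.
  have intt := integrable_step (a := fun i => phi (pt n i)) measurableT lamoo
    mphit (fun u _ => clt n u) (fun u _ => he u).
  have -> : \int[tau]_(x in X) phi x = \int[lam]_u (phi \o t) u.
    rewrite Rintegral_mkcond /Rintegral integral_pushforward//.
    - by congr fine; apply: eq_integral => u _ /=; rewrite phit.
    - exact/measurable_EFinP.
    - rewrite preimage_setT.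
      apply: eq_integrable intt => // u _ /=; by rewrite phit.
  have := @Rintegral_step _ _ _ lam setT (c n) (2 ^ n)%N (fun i => phi (pt n i))
    (phi \o t) e.
  rewrite lamT mulr1.
  move=> /(_ measurableT (ltry _) (mc n) mphit (fun u _ => clt n u) (fun u _ => he u)).
  rewrite (eq_bigr (fun i : 'I_(2 ^ n) => phi (pt n i) * (G n i.+1 - G n i)))//.
  move=> i _; congr (_ * _).
  have Gi0 : 0 <= G n i.
    apply: (cvgr_to_ge (hG n i)); apply: nearW => j.
    by have /andP[] := F01 (s j) n i.
  have Gi1 : G n i.+1 <= 1.
    apply: (cvgr_to_le (hG n i.+1)); apply: nearW => j.
    by have /andP[] := F01 (s j) n i.+1.
  rewrite setIT /lam/= /mrestr (_ : _ `&` D = [set` `[G n i, G n i.+1[%R]).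
    by rewrite lebesgue_measure_itv/= lte_fin; have := Gle n i (ltn_ord i);
      rewrite le_eqVlt => /predU1P[->|->]; rewrite ?ltxx ?subrr.
  apply/seteqP; split => u /=; rewrite in_itv/=.
    by move=> [/(cE _ _ _ (ltn_ord i))+ Du]; rewrite clipD.
  move=> /andP[Gu uG].
  have Du : D u by rewrite /D/= in_itv/= (le_trans Gi0 Gu) (lt_le_trans uG).
  by split => //; apply/(cE _ _ _ (ltn_ord i)); rewrite clipD// Gu uG.
have intnu j e n : (forall x, X x -> `|phi x - phi (pt n (code B n x))| <= e) ->
    `|\int[nu j]_(x in X) phi x -
     \sum_(i < 2 ^ n) phi (pt n i) * (F j n i.+1 - F j n i)| <= e.
  move=> he.
  have := @Rintegral_step _ _ _ (nu j) X (code B n) (2 ^ n)%N (fun i => phi (pt n i))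
    phi e.
  rewrite nuX mulr1.
  move=> /(_ mX (ltry _) (mcell n) mphi (fun x _ => code_lt B n x) he).
  rewrite (eq_bigr (fun i : 'I_(2 ^ n) => phi (pt n i) * (F j n i.+1 - F j n i)))//.
  by move=> i _; rewrite FS addrC addKr.
apply/cvgrPdist_le => e e0.
have [|n [hn1 hn2]] := approx (e / 4); first by rewrite divr_gt0.
have cvsum : \sum_(i < 2 ^ n) phi (pt n i) * (F (s j) n i.+1 - F (s j) n i) @[j --> \oo]
    --> \sum_(i < 2 ^ n) phi (pt n i) * (G n i.+1 - G n i).
  apply: cvg_big => [|i _]; first exact: add_continuous.
  by apply: cvgMr; apply: cvgB; exact: hG.
have e2 : 0 < e / 2 by rewrite divr_gt0.
move/cvgrPdist_le : cvsum => /(_ _ e2); apply: filterS => j hj.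
have h1 := inttau _ _ hn2; have h2 := intnu (s j) _ _ hn1.
move: h1 h2 hj.
set a := Rintegral _ _ _; set b := Rintegral _ _ _; set x := \sum_(i < _) _;
  set y := \sum_(i < _) _.
move=> h1 h2 hj.
rewrite (_ : a - b = (a - x) + (x - y) - (b - y)); last by ring.
rewrite (le_trans (ler_normB _ _))// (_ : e = (e / 4 + e / 2) + e / 4); last by lra.
by rewrite lerD// (le_trans (ler_normD _ _))// lerD.
Qed.

(** * Euclidean balls *)

Section euclidean_norm.
Context {R : realType} {d : nat}.
Implicit Types (x y : 'rV[R]_d) (r : R).

Lemma enorm_ge0 x : 0 <= enorm x.
Proof. exact: sqrtr_ge0. Qed.

Lemma enorm0 : enorm (0 : 'rV[R]_d) = 0.
Proof. by rewrite /enorm big1 ?sqrtr0// => i _; rewrite mxE expr0n. Qed.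

Lemma enormZ a x : enorm (a *: x) = `|a| * enorm x.
Proof.
rewrite /enorm -[ `|a|]sqrtr_sqr -sqrtrM ?sqr_ge0//; congr Num.sqrt.
by rewrite mulr_sumr; apply: eq_bigr => i _; rewrite mxE exprMn.
Qed.

Lemma coord_le_enorm x i : `|x 0 i| <= enorm x.
Proof.
rewrite /enorm -[ `|x 0 i|]sqrtr_sqr ler_sqrt.
  by rewrite (bigD1 i)//= lerDl sumr_ge0// => j _; exact: sqr_ge0.
by rewrite sumr_ge0// => j _; exact: sqr_ge0.
Qed.

Lemma enorm_continuous : continuous (@enorm R d).
Proof.
move=> y; apply: (@continuous_comp _ _ _ (fun y : 'rV[R]_d =>
  \sum_(i < d) y 0 i ^+ 2) Num.sqrt); last exact: sqrt_continuous.
apply: continuous_big => [|i _]; first exact: add_continuous.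
move=> z; apply: (@continuous_comp _ _ _ (fun z : 'rV[R]_d => z 0 i)
  (fun z => z ^+ 2)); last exact: exprn_continuous.
exact: coord_continuous.
Qed.

Definition cube (M : R) : set 'rV[R]_d := [set x | forall i, `|x 0 i| <= M].

Lemma compact_cube M : compact (cube M).
Proof.
have := @rV_compact R d (fun=> `[(- M), M]%classic) (fun=> @segment_compact _ _ _).
congr compact; apply/seteqP; split => x /= h i; have := h i;
  by rewrite in_itv/= ler_norml.
Qed.

Lemma closed_measurable_borelRd (A : set 'rV[R]_d) :
  closed A -> measurable (A : set (borelRd R d)).
Proof.
move=> clA; rewrite -[A]setCK; apply: measurableC; apply: sub_sigma_algebra.
exact: closed_openC.
Qed.

Lemma closed_cube M : closed (cube M).
Proof. by apply: compact_closed; [exact: norm_hausdorff|exact: compact_cube]. Qed.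

Lemma closed_eclosed_ball r : closed (eclosed_ball (0 : 'rV[R]_d) r).
Proof.
rewrite (_ : eclosed_ball _ _ = @enorm R d @^-1` [set s | s <= r]); last first.
  by apply/seteqP; split => y; rewrite /eclosed_ball /= subr0.
by apply: preimage_closed (@closed_le _ r) => y _; exact: enorm_continuous.
Qed.

Lemma compact_eclosed_ball r : compact (eclosed_ball (0 : 'rV[R]_d) r).
Proof.
apply: (@subclosed_compact _ _ (cube r));
  [exact: closed_eclosed_ball|exact: compact_cube|move=> y].
rewrite /eclosed_ball /= subr0 => yr i; exact: le_trans (coord_le_enorm y i) yr.
Qed.

Lemma linear_le_enorm (f : {linear 'rV[R]_d -> R^o}) x :
  `|f x| <= (\sum_(j < d) `|f (delta_mx 0 j)|) * enorm x.
Proof.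
rewrite [in leLHS](row_sum_delta x) linear_sum mulr_suml.
apply: (le_trans (ler_norm_sum _ _ _)); apply: ler_sum => j _.
by rewrite linearZ/= normrM mulrC ler_wpM2l// coord_le_enorm.
Qed.

End euclidean_norm.

(** * Decay of invariant measures at the origin *)

Lemma sum_measure_disjoint d (S : measurableType d) (R : realType)
    (mu : {measure set S -> \bar R}) (I : finType) (F : I -> set S) (U : set S) :
  (forall i, measurable (F i)) -> trivIset setT F -> measurable U ->
  (forall i, F i `<=` U) -> (\sum_i mu (F i) <= mu U)%E.
Proof.
move=> mF tF mU FU; rewrite fsbig_seq ?index_enum_uniq//.
rewrite -measure_fin_bigcup//.
- apply: le_measure; [apply/mem_set|exact/mem_set|].
    exact: fin_bigcup_measurable.
  by apply: bigcup_sub => i _; exact: FU.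
- exact: sub_trivIset tF.
Qed.

(** Packing: the translates of B (0, r) by the vectors h (a_1 e_1 + ... + a_n
e_n), where e is a basis of V, 0 <= a_i < m, h is of order r and m of order
r^-1, are disjoint and stay in a fixed cube. The m^n values of t on them are
equal, and their absolute values add up to at most the mass of both parts of t
on the cube. *)
Lemma invariant_radon_ball (R : realType) (d : nat) (V : {vspace 'rV[R]_d})
    (t : real_radon setT) : invariant_radon V t ->
  exists C : R, forall r, 0 < r <= 1 ->
    `|rr_val t (eball 0 r)| <= C * r ^+ \dim V.
Proof.
move=> invt; set n := \dim V.
(* K bounds the coordinates in the basis of V, extended to the whole space, by
   the Euclidean norm; W bounds the entries of the vectors of the basis. *)
pose K : R := 1 + \sum_(i < n) \sum_(j < d) `|coord (vbasis V) i (delta_mx 0 j)|.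
have K0 : 0 < K by rewrite ltr_pwDl// sumr_ge0// => i _; rewrite sumr_ge0.
have Kcoord i y : `|coord (vbasis V) i y| <= K * enorm y.
  apply: le_trans (linear_le_enorm (coord (vbasis V) i) y) _.
  rewrite ler_wpM2r ?enorm_ge0// /K (bigD1 i)//= addrCA lerDl addr_ge0//.
  by rewrite sumr_ge0// => k _; rewrite sumr_ge0.
pose W : R := 1 + \sum_(i < n) \sum_(j < d) `|(vbasis V)`_i 0 j|.
have W0 : 0 < W by rewrite ltr_pwDl// sumr_ge0// => i _; rewrite sumr_ge0.
pose M : R := 2 + 2 * K * W.
have mE (y : 'rV[R]_d) r : measurable (eball y r : set (borelRd R d)).
  exact: measurable_eball.
have mM : measurable (cube M : set (borelRd R d)).
  by apply: closed_measurable_borelRd; exact: closed_cube.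
have [_ posf] := rr_posP t; have [_ negf] := rr_negP t.
have posM := posf _ (@compact_cube R d M) (@subsetT _ _).
have negM := negf _ (@compact_cube R d M) (@subsetT _ _).
pose C0 := fine (rr_pos t (cube M)) + fine (rr_neg t (cube M)).
exists (C0 * (2 * K * W) ^+ n) => r /andP[r0 r1].
pose z := (2 * K * W * r)^-1.
have z0 : 0 < z by rewrite invr_gt0 !mulr_gt0.
pose m := (Num.truncn z).+1.
have mz : z < m%:R by exact: truncnS_gt.
have mz1 : m%:R <= z + 1.
  by rewrite -natr1 lerD2r; have /andP[] := truncn_itv (ltW z0).
(* Two centres with different i-th coefficients have i-th coordinates at
   distance at least h, whereas the i-th coordinate varies by less than K r on a
   ball of radius r around its centre. *)
pose h := 2 * K * r.
have h0 : 0 < h by rewrite !mulr_gt0.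
have hmW : h * m%:R * W <= 1 + 2 * K * W.
  have hzW : h * z * W = 1.
    by rewrite /h /z; field; rewrite !gt_eqF.
  have : h * m%:R * W <= h * (z + 1) * W by rewrite ler_pM2r// ler_pM2l.
  rewrite (_ : h * (z + 1) * W = 1 + h * W);
    last by rewrite [h * _]mulrDr mulr1 mulrDl hzW.
  move=> /le_trans; apply; rewrite lerD2l /h ler_pM2r//.
  by rewrite -[leRHS]mulr1 ler_pM2l// mulr_gt0.
pose v (a : {ffun 'I_n -> 'I_m}) : 'rV[R]_d :=
  \sum_(i < n) (h * (a i : nat)%:R) *: (vbasis V)`_i.
have vV a : v a \in V.
  rewrite memv_suml// => i _; rewrite memvZ// vbasis_mem// mem_nth//.
  by rewrite size_tuple.
have coordv a i : coord (vbasis V) i (v a) = h * (a i : nat)%:R.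
  exact: (coord_sum_free (fun i : 'I_n => h * (a i : nat)%:R) i (basis_free (vbasisP V))).
have vM a j : `|v a 0 j| <= 1 + 2 * K * W.
  apply: le_trans hmW; rewrite /v summxE (le_trans (ler_norm_sum _ _ _))//.
  apply: (@le_trans _ _ (h * m%:R * (W - 1))); last first.
    by rewrite ler_pM2l ?mulr_gt0// gerBl.
  rewrite /W addrAC subrr add0r mulr_sumr; apply: ler_sum => i _.
  rewrite mxE normrM; apply: ler_pM => //; last first.
    by rewrite (bigD1 j)//= lerDl sumr_ge0.
  rewrite ger0_norm; last by rewrite mulr_ge0// ltW.
  by rewrite ler_pM2l// ler_nat; exact: ltnW (ltn_ord _).
have eqv (a b : {ffun 'I_n -> 'I_m}) (y : 'rV[R]_d) :
    enorm (y - v a) < r -> enorm (y - v b) < r -> a = b.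
  move=> ya yb; apply/ffunP => i.
  have : h * `|(a i : nat)%:R - (b i : nat)%:R| < h.
    rewrite -[X in X * _](gtr0_norm h0) -normrM mulrBr -!coordv -linearB/=.
    rewrite (_ : v a - v b = (y - v b) - (y - v a)); last first.
      by rewrite opprB [RHS]addrC subrKA.
    rewrite linearB/= (le_lt_trans (ler_normB _ _))//.
    rewrite /h -mulrA mulr_natl mulr2n.
    by apply: ltrD; apply: le_lt_trans (Kcoord i _) _; rewrite ltr_pM2l.
  rewrite -[ltRHS]mulr1 ltr_pM2l// => ab1; apply/val_inj => /=.
  move: ab1; set p := nat_of_ord (a i); set q := nat_of_ord (b i).
  rewrite ltr_norml => /andP[]; rewrite ltrBrDr ltrBlDr addrC => pq qp.
  have {}qp : (p < q.+1)%N by rewrite -(ltr_nat R) -natr1 addrC.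
  have {}pq : (q < p.+1)%N by rewrite -(ltr_nat R) -natr1; lra.
  lia.
have rrE a : rr_val t (eball (v a) r) = rr_val t (eball 0 r).
  have vaV : - v a \in V by rewrite memvN.
  rewrite -(invt _ vaV (eball 0 r) (cube M)) //.
  - congr rr_val; apply/seteqP; split => y; rewrite /eball /= subr0//.
  - exact: compact_cube.
  - move=> y; rewrite /eball /= subr0 => yr j.
    rewrite (le_trans (coord_le_enorm _ _))// (le_trans (ltW yr))// (le_trans r1)//.
    rewrite /M -addrA lerDl addr_ge0 ?mulr_ge0 ?(ltW K0) ?(ltW W0)//.
have FM a : eball (v a) r `<=` cube M.
  move=> y yr j; rewrite (_ : y = (y - v a) + v a); last by rewrite subrK.
  rewrite mxE (le_trans (ler_normD _ _))// /M (_ : 2 + 2 * K * W = 1 + (1 + 2 * K * W));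
    last by ring.
  rewrite lerD ?vM// (le_trans (coord_le_enorm _ _))// ltW// (lt_le_trans yr)//.
have tF : trivIset setT (fun a => eball (v a) r).
  apply/trivIsetP => a b _ _ /eqP ab; apply/seteqP; split => // y [ya yb].
  by apply: ab; exact: (eqv a b y).
have sumle (mu : {measure set (borelRd R d) -> \bar R}) :
    (mu (cube M) < +oo)%E ->
    \sum_a fine (mu (eball (v a) r)) <= fine (mu (cube M)).
  move=> muM; have fM : mu (cube M) \is a fin_num by rewrite ge0_fin_numE ?measure_ge0.
  have fF a : mu (eball (v a) r) \is a fin_num.
    rewrite ge0_fin_numE ?measure_ge0//; apply: le_lt_trans muM.
    by apply: le_measure; [apply/mem_set; exact: mE|apply/mem_set; exact: mM|exact: FM].
  rewrite -lee_fin fineK// -sumEFin (eq_bigr (fun a => mu (eball (v a) r))).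
    by apply: sum_measure_disjoint => // a; exact: mE.
  by move=> a _; rewrite fineK.
have key : (m ^ n)%:R * `|rr_val t (eball 0 r)| <= C0.
  have <- : \sum_(a : {ffun 'I_n -> 'I_m}) `|rr_val t (eball (v a) r)| =
      (m ^ n)%:R * `|rr_val t (eball 0 r)|.
    under eq_bigr do rewrite rrE.
    by rewrite sumr_const card_ffun !card_ord mulr_natl.
  apply: (@le_trans _ _ (\sum_(a : {ffun 'I_n -> 'I_m})
    (fine (rr_pos t (eball (v a) r)) + fine (rr_neg t (eball (v a) r))))).
    apply: ler_sum => a _; rewrite /rr_val (le_trans (ler_normB _ _))//.
    by rewrite !ger0_norm ?fine_ge0 ?measure_ge0.
  by rewrite big_split /C0 lerD// sumle.
have zn : z ^+ n <= (m ^ n)%:R.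
  by rewrite natrX lerXn2r ?nnegrE ?(ltW z0)// ltW.
rewrite (_ : C0 * _ * _ = C0 / z ^+ n); last first.
  by rewrite /z exprVn invrK [in RHS]exprMn mulrA.
rewrite ler_pdivlMr ?exprn_gt0// mulrC; apply: le_trans key.
by rewrite ler_wpM2r.
Qed.

(** * Blow-ups of a measure along windows of scales *)

(** If from k0 on every value of g were followed within L steps by a smaller
one, then, hopping along such values, one would find a value at most g k0 within
L steps before any n, whence g n <= q^L g k0: g would be bounded. *)
Lemma submultiplicative_window (R : realDomainType) (g : nat -> R) (q : R) :
  1 <= q -> (forall k, 0 <= g k) -> (forall k, g k.+1 <= q * g k) ->
  (forall C, exists k, C < g k) ->
  forall L k0, exists2 k, (k0 <= k)%N & forall i, (i <= L)%N -> g k <= g (k + i)%N.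
Proof.
move=> q1 g0 gq unb L k0.
have q0 : 0 <= q by exact: le_trans q1.
have gD k j : g (k + j)%N <= q ^+ j * g k.
  elim: j => [|j ih]; first by rewrite addn0 expr0 mul1r.
  by rewrite addnS (le_trans (gq _))// exprS -mulrA ler_wpM2l.
have gDle k j N : (j <= N)%N -> g (k + j)%N <= q ^+ N * g k.
  by move=> jN; rewrite (le_trans (gD _ _))// ler_wpM2r// ler_weXn2l.
apply: contrapT => no.
have drop k : (k0 <= k)%N -> exists2 i, (i <= L)%N & g (k + i)%N < g k.
  move=> k0k; apply: contrapT => no'; apply: no; exists k => // i iL.
  by rewrite leNgt; apply/negP => gi; apply: no'; exists i.
have chain n : exists k,
    [/\ (k <= k0 + n)%N, (k0 + n <= k + L)%N, (k0 <= k)%N & g k <= g k0].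
  elim: n => [|n [k [kn nk k0k gk]]]; first by exists k0; rewrite addn0 leq_addr !leqnn.
  have [kL|kL] := leqP (k0 + n.+1) (k + L)%N; first by exists k; split => //; lia.
  have [i iL gi] := drop k k0k.
  have i0 : (0 < i)%N by case: i gi {iL} => //; rewrite addn0 ltxx.
  by exists (k + i)%N; split; [lia|lia|lia|exact: le_trans (ltW gi) gk].
have [n] := unb (q ^+ L * g k0 + q ^+ k0 * g 0%N).
apply/negP; rewrite -leNgt; have [k0n|nk0] := leqP k0 n.
  have [k [kn nk k0k gk]] := chain (n - k0)%N.
  rewrite ler_wpDr ?mulr_ge0 ?exprn_ge0// (_ : n = k + (n - k))%N; last by lia.
  by rewrite (le_trans (gDle _ _ L _)) ?ler_wpM2l ?exprn_ge0//; lia.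
by rewrite ler_wpDl ?mulr_ge0 ?exprn_ge0// -[n]add0n gDle// ltnW.
Qed.

Lemma Rintegral_between d (S : measurableType d) (R : realType)
    (mu : {measure set S -> \bar R}) (X A : set S) (f : S -> R) :
  measurable X -> measurable A -> (mu X < +oo)%E -> measurable_fun X f ->
  (forall x, X x -> 0 <= f x <= 1) ->
  (A `<=` X -> (forall x, A x -> f x = 1) -> fine (mu A) <= \int[mu]_(x in X) f x) /\
  ((forall x, X x -> ~ A x -> f x = 0) -> \int[mu]_(x in X) f x <= fine (mu (A `&` X))).
Proof.
move=> mX mA muX mf f01.
have intf : mu.-integrable X (EFin \o f).
  apply: measurable_bounded_integrable => //; exists 1; split; first by rewrite num_real.
  move=> M M1 x Xx /=; have /andP[f0 f1] := f01 _ Xx.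
  by rewrite ger0_norm// (le_trans f1)// ltW.
have intA : mu.-integrable X (EFin \o \1_A).
  apply: measurable_bounded_integrable => //; exists 1; split; first by rewrite num_real.
  move=> M M1 x _ /=; apply/ltW/le_lt_trans/M1.
  by rewrite indicE; case: (_ \in _); rewrite /= ?normr1 ?normr0.
have IA : \int[mu]_(x in X) \1_A x = fine (mu (A `&` X)).
  by rewrite /Rintegral integral_indic.
split => [AX fA|fA].
  rewrite -[A in leLHS](setIidl AX) -IA; apply: le_Rintegral => // x Xx.
  rewrite indicE; have [Ax|Ax] := pselect (A x); first by rewrite mem_set// fA.
  by rewrite memNset//; have /andP[] := f01 _ Xx.
rewrite -IA; apply: le_Rintegral => // x Xx.
rewrite indicE; have [Ax|Ax] := pselect (A x).
  by rewrite mem_set//; have /andP[] := f01 _ Xx.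
by rewrite memNset// fA.
Qed.

Lemma rescale_eball (R : realType) (d : nat) (x : 'rV[R]_d) (r s : R) : 0 < r ->
  rescale x r @^-1` eball 0 s = eball x (s * r).
Proof.
move=> r0; apply/seteqP; split => y; rewrite /eball /rescale /= subr0 enormZ;
  by rewrite gtr0_norm ?invr_gt0// -ltr_pdivlMl ?invr_gt0// invrK mulrC.
Qed.

Lemma eballS (R : realType) (d : nat) (x : 'rV[R]_d) (r s : R) :
  r <= s -> eball x r `<=` eball x s.
Proof. by move=> rs y; rewrite /eball /=; move/lt_le_trans; apply. Qed.

Lemma blowup_eball (R : realType) (d : nat)
    (mu : {measure set (borelRd R d) -> \bar R}) (x : 'rV[R]_d) (r s : R) :
  0 < r -> s <= 1 -> blowup mu x r (eball 0 s) =
  ((fine (mu (eball x r)))^-1%:E * mu (eball x (s * r)))%E.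
Proof.
move=> r0 s1; rewrite /blowup /pushforward setIidl; last exact: eballS.
by rewrite rescale_eball.
Qed.

Lemma blowup_ball1 (R : realType) (d : nat)
    (mu : {measure set (borelRd R d) -> \bar R}) (x : 'rV[R]_d) (r : R) :
  0 < r -> (0 < mu (eball x r) < +oo)%E -> blowup mu x r (eclosed_ball 0 1) = 1%E.
Proof.
move=> r0 /andP[mu0 muoo]; rewrite /blowup /pushforward setIidr; last first.
  by move=> y; rewrite /eball /eclosed_ball /=; exact: ltW.
rewrite rescale_eball// mul1r.
have muf : mu (eball x r) \is a fin_num by rewrite ge0_fin_numE ?measure_ge0.
rewrite -[X in (_ * X)%E]fineK// -EFinM mulVf// gt_eqF//.
by rewrite -lte_fin fineK.
Qed.

(** Continuous functions between the indicators of B (0, r) and of B (0, 2 r),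
through which weak-* convergence controls the masses of balls. *)
Definition cutoff {R : realType} {d : nat} (r : R) (y : 'rV[R]_d) : R :=
  Num.max 0 (Num.min 1 (2 - r^-1 * enorm y)).

Lemma cutoff_continuous {R : realType} {d : nat} (r : R) :
  continuous (@cutoff R d r).
Proof.
move=> y; apply: (@continuous_max R _ (fun=> 0)
  (fun y => Num.min 1 (2 - r^-1 * enorm y))); first exact: cst_continuous.
apply: (@continuous_min R _ (fun=> 1) (fun y => 2 - r^-1 * enorm y)).
  exact: cst_continuous.
apply: continuousB; first exact: cst_continuous.
by apply: continuousM; [exact: cst_continuous|exact: enorm_continuous].
Qed.

Lemma cutoff01 {R : realType} {d : nat} (r : R) (y : 'rV[R]_d) :
  0 <= cutoff r y <= 1.
Proof. by rewrite /cutoff le_max lexx/= ge_max ler01 ge_min lexx. Qed.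

Lemma cutoff_in {R : realType} {d : nat} (r : R) (y : 'rV[R]_d) :
  0 < r -> eball 0 r y -> cutoff r y = 1.
Proof.
move=> r0; rewrite /eball /= subr0 => yr; rewrite /cutoff min_l ?max_r//.
by rewrite lerBrDl -lerBrDr ler_pdivrMl// mulrBr; lra.
Qed.

Lemma cutoff_out {R : realType} {d : nat} (r : R) (y : 'rV[R]_d) :
  0 < r -> ~ eball 0 (2 * r) y -> cutoff r y = 0.
Proof.
move=> r0; rewrite /eball /= subr0 => /negP; rewrite -leNgt => yr.
have h : 2 - r^-1 * enorm y <= 0 by rewrite subr_le0 ler_pdivlMl// mulrC.
by rewrite /cutoff max_l// ge_min h orbT.
Qed.

Definition nonneg_real_radon (R : realType) (d : nat) (X : set 'rV[R]_d)
    (tau : {measure set (borelRd R d) -> \bar R}) (tauP : radon_on X tau) :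
    real_radon X :=
  @RealRadon R d X tau mzero tauP (conj erefl (fun _ _ _ => ltry 0)).

Lemma rr_val_nonneg (R : realType) (d : nat) (X : set 'rV[R]_d)
    (tau : {measure set (borelRd R d) -> \bar R}) (tauP : radon_on X tau) A :
  rr_val (nonneg_real_radon tauP) A = fine (tau A).
Proof. exact: subr0. Qed.

Lemma eball_sub_closed1 (R : realType) (d : nat) (s : R) : s <= 1 ->
  eball (0 : 'rV[R]_d) s `<=` eclosed_ball 0 1.
Proof. by move=> s1 y; rewrite /eball /eclosed_ball /= => /ltW/le_trans; apply. Qed.

(** The blow-ups are taken at the first scales [rad (K j)] of windows of length
j, so that for j >= i they give B (0, 2^-i) a mass of at least q^-i. In the
limit one factor q is lost: a cutoff function that vanishes outside B (0, 2^-i)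
is bounded from below through the mass of B (0, 2^-(i + 1)). *)
Lemma tangent_lower_bound (R : realType) (d : nat) (q : R)
    (mu : {measure set (borelRd R d) -> \bar R}) (x : 'rV[R]_d) (k0 : nat) :
  1 <= q ->
  (forall k, (k0 <= k)%N -> (mu (eball x (2^-1 ^+ k)) < +oo)%E) ->
  (forall C, exists2 k, (k0 <= k)%N & C < fine (mu (eball x (2^-1 ^+ k))) * q ^+ k) ->
  exists2 tau : real_radon (eclosed_ball 0 1), tangent_measure mu x tau &
    forall i, q ^- i.+1 <= rr_val tau (eball 0 (2^-1 ^+ i)).
Proof.
move=> q1 muoo unb.
have q0 : 0 < q by exact: lt_le_trans q1.
pose rad k : R := 2^-1 ^+ (k0 + k).
have rad0 k : 0 < rad k by rewrite exprn_gt0// invr_gt0.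
have radD k i : rad (k + i)%N = 2^-1 ^+ i * rad k by rewrite /rad addnA exprD mulrC.
have radS k i : rad (k + i)%N <= rad k.
  by rewrite radD ler_piMl ?(ltW (rad0 k))// exprn_ile1// ?invr_ge0// invf_le1 ?ler1n.
pose m k : R := fine (mu (eball x (rad k))).
have mfin k : mu (eball x (rad k)) \is a fin_num.
  by rewrite ge0_fin_numE ?measure_ge0// muoo// leq_addr.
have mS k i : m (k + i)%N <= m k.
  rewrite /m -lee_fin !fineK//; apply: le_measure.
  - apply/mem_set; exact: measurable_eball.
  - apply/mem_set; exact: measurable_eball.
  - exact: eballS.
pose g k : R := m k * q ^+ k.
have m0 k : 0 <= m k by rewrite fine_ge0// measure_ge0.
have g0 k : 0 <= g k by rewrite mulr_ge0// exprn_ge0// ltW.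
have gS k : g k.+1 <= q * g k.
  rewrite /g exprS mulrCA ler_wpM2l ?(ltW q0)// ler_wpM2r ?exprn_ge0 ?(ltW q0)//.
  by rewrite -addn1.
have gunb C : exists k, C < g k.
  have [k k0k Ck] := unb (C * q ^+ k0); exists (k - k0)%N.
  by rewrite /g /m /rad subnKC// -(ltr_pM2r (exprn_gt0 k0 q0)) -mulrA -exprD subnK.
have win := submultiplicative_window q1 g0 gS gunb.
(* If m k were 0 then g would vanish from k on, and would be bounded. *)
have mpos k : 0 < m k.
  have [N gN] := gunb (\sum_(i < k) g i).
  have kN : (k <= N)%N.
    rewrite leqNgt; apply/negP => Nk; move: gN; apply/negP; rewrite -leNgt.
    by rewrite (bigD1 (Ordinal Nk))//= lerDl sumr_ge0.
  have gN0 : 0 < g N by apply: le_lt_trans gN; rewrite sumr_ge0.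
  apply: lt_le_trans (_ : m N <= m k).
    by move: gN0; rewrite /g pmulr_lgt0// exprn_gt0.
  by rewrite -(subnKC kN).
have mupos k : (0 < mu (eball x (rad k)) < +oo)%E.
  by rewrite muoo ?leq_addr// andbT -(fineK (mfin k)) lte_fin mpos.
have /choice[f hf] (p : nat * nat) : exists k, (p.2 <= k)%N /\
    forall i, (i <= p.1)%N -> g k <= g (k + i)%N.
  by have [k pk kg] := win p.1 p.2; exists k.
pose K := fix K n := if n is p.+1 then f (n, (K p).+1) else f (0%N, 0%N).
have KS j : (K j < K j.+1)%N by have [] := hf (j.+1, (K j).+1).
have Kwin j i : (i <= j)%N -> g (K j) <= g (K j + i)%N.
  by case: j => [|j]; [have [_] := hf (0%N, 0%N)|have [_] := hf (j.+1, (K j).+1)]; exact.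
pose nu j : {measure set (borelRd R d) -> \bar R} := blowup mu x (rad (K j)).
have nu1 j : nu j (eclosed_ball 0 1) = 1%E by exact: blowup_ball1.
have nuge i j : (i <= j)%N -> ((q ^- i)%:E <= nu j (eball 0 (2^-1 ^+ i)))%E.
  move=> ij; have -> : nu j (eball 0 (2^-1 ^+ i)) =
    blowup mu x (rad (K j)) (eball 0 (2^-1 ^+ i)) by [].
  rewrite blowup_eball//; last first.
    by rewrite exprn_ile1// ?invr_ge0// invf_le1 ?ler1n.
  rewrite -radD -(fineK (mfin (K j + i)%N)) -EFinM lee_fin -/(m _) -/(m _).
  rewrite ler_pdivlMl ?mpos// ler_pdivrMr ?exprn_gt0//.
  rewrite -(ler_pM2r (exprn_gt0 (K j) q0)) -mulrA -exprD [(i + _)%N]addnC.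
  exact: Kwin.
have cX : compact (eclosed_ball (0 : 'rV[R]_d) 1) by exact: compact_eclosed_ball.
have clX : closed (eclosed_ball (0 : 'rV[R]_d) 1) by exact: closed_eclosed_ball.
have [s [tau [sS tau0 tau1 cvtau]]] :=
  @weak_star_compactness R _ (eclosed_ball 0 1) nu cX clX nu1.
have tauP : radon_on (eclosed_ball 0 1) tau.
  split => // A cA AX; apply: (@le_lt_trans _ _ (tau (eclosed_ball 0 1))).
    apply: le_measure => //; apply/mem_set; apply: closed_measurable_borelRd.
      by apply: compact_closed => //; exact: norm_hausdorff.
    exact: closed_eclosed_ball.
  by rewrite tau1 ltry.
have sge j : (j <= s j)%N.
  by elim: j => // j ih; exact: leq_ltn_trans ih (sS j).
have Kge j : (j <= K j)%N.
  by elim: j => // j ih; exact: leq_ltn_trans ih (KS j).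
exists (nonneg_real_radon tauP).
  exists (fun j => rad (K (s j))); split => //.
  - apply/nonincreasing_seqP => j.
    have : (K (s j) <= K (s j.+1))%N.
      have /subnK <- := ltnW (sS j).
      elim: (s j.+1 - s j)%N => // n ih; rewrite addSn.
      exact: leq_trans ih (ltnW (KS _)).
    by move=> /subnKC <-; exact: radS.
  - apply: (@squeeze_cvgr _ _ _ _ (fun=> 0) (fun j => 2^-1 ^+ j)).
    + apply: nearW => j; rewrite (ltW (rad0 _))/=.
      rewrite /rad ler_wiXn2l ?invr_ge0 ?invf_le1 ?ler1n//.
      by rewrite (leq_trans (sge j))// (leq_trans (Kge _))// leq_addl.
    + exact: cvg_cst.
    + by apply: cvg_expr; rewrite ger0_norm ?invr_ge0// invf_lt1 ?ltr1n.
  - move=> phi cphi; rewrite /rr_integral /=.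
    rewrite [X in _ - X](_ : _ = 0) ?subr0; first exact: cvtau.
    by rewrite /Rintegral integral_measure_zero.
move=> i; rewrite rr_val_nonneg.
have pow1 n : (2^-1 ^+ n : R) <= 1 by rewrite exprn_ile1// ?invr_ge0// invf_le1 ?ler1n.
have r0 : 0 < (2^-1 ^+ i.+1 : R) by rewrite exprn_gt0// invr_gt0.
have cphi : {within eclosed_ball 0 1,
    continuous (cutoff (2^-1 ^+ i.+1 : R) : 'rV[R]_d -> R)}.
  by apply: continuous_subspaceT; exact: cutoff_continuous.
have mX : measurable (eclosed_ball 0 1 : set (borelRd R d)).
  by apply: closed_measurable_borelRd; exact: closed_eclosed_ball.
have mphi := within_continuous_measurable clX cphi.
have mB r : measurable (eball 0 r : set (borelRd R d)) by exact: measurable_eball.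
have phi01 (y : 'rV[R]_d) : eclosed_ball 0 1 y -> 0 <= cutoff (2^-1 ^+ i.+1 : R) y <= 1.
  by move=> _; exact: cutoff01.
have half1 : 2 * 2^-1 ^+ i.+1 = 2^-1 ^+ i :> R by rewrite exprS mulVKf.
apply: (@le_trans _ _ (\int[tau]_(y in eclosed_ball 0 1) cutoff (2^-1 ^+ i.+1) y)).
  apply: (cvgr_to_ge (cvtau _ cphi)).
  exists i.+1 => // j /= ij.
  have nuX : (nu (s j) (eclosed_ball 0 1) < +oo)%E by rewrite nu1 ltry.
  have [h _] := Rintegral_between mX (mB (2^-1 ^+ i.+1)) nuX mphi phi01.
  apply: le_trans (h _ _).
  - rewrite -lee_fin fineK; first exact/nuge/(leq_trans ij).
    rewrite ge0_fin_numE ?measure_ge0//; apply: le_lt_trans nuX.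
    by apply: le_measure; [apply/mem_set; exact: mB|apply/mem_set; exact: mX|
      exact: eball_sub_closed1].
  - exact: eball_sub_closed1.
  - by move=> y; exact: cutoff_in.
have tauX : (tau (eclosed_ball 0 1) < +oo)%E by rewrite tau1 ltry.
have [_ h] := Rintegral_between mX (mB (2^-1 ^+ i)) tauX mphi phi01.
rewrite setIidl in h; last exact: eball_sub_closed1.
by apply: h => y _; rewrite -half1; exact: cutoff_out.
Qed.

(** Otherwise [tangent_lower_bound] and [invariant_radon_ball] give q^-(i + 1)
<= D 2^(- l i) for all i, which fails for large i as q < 2^l. *)
Lemma split_tangent_growth (R : realType) (d l n : nat) (q : R)
    (mu : {measure set (borelRd R d) -> \bar R}) (x : 'rV[R]_d) (k0 : nat) :
  1 <= q < 2 ^+ l ->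
  (forall k, (k0 <= k)%N -> (mu (eball x (2^-1 ^+ k)) < +oo)%E) ->
  (forall tau : real_radon (eclosed_ball 0 1), tangent_measure mu x tau ->
    exists (t : 'I_n -> real_radon setT) (V : 'I_n -> {vspace 'rV[R]_d}),
      (forall h, invariant_radon (V h) (t h) /\ (l <= \dim (V h))%N) /\
      (forall A : set (borelRd R d), measurable A -> A `<=` eball 0 1 ->
         rr_val tau A = \sum_(h < n) rr_val (t h) A)) ->
  exists C, forall k, (k0 <= k)%N -> (mu (eball x (2^-1 ^+ k)) <= (C * q ^- k)%:E)%E.
Proof.
move=> /andP[q1 ql] muoo split.
have q0 : 0 < q by exact: lt_le_trans q1.
apply: contrapT => /forallNP no.
have unb C : exists2 k, (k0 <= k)%N & C < fine (mu (eball x (2^-1 ^+ k))) * q ^+ k.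
  apply: contrapT => no'; apply: (no C) => k k0k.
  have muf : mu (eball x (2^-1 ^+ k)) \is a fin_num.
    by rewrite ge0_fin_numE ?measure_ge0// muoo.
  rewrite -(fineK muf) lee_fin ler_pdivlMr ?exprn_gt0// leNgt; apply/negP => Ck.
  by apply: no'; exists k.
have [tau /split[t [V [tV tauE]]] taulow] := tangent_lower_bound q1 muoo unb.
have /choice[C hC] (h : 'I_n) : exists C : R, forall r, 0 < r <= 1 ->
    `|rr_val (t h) (eball 0 r)| <= C * r ^+ l.
  have [inv ldim] := tV h; have [C hC] := invariant_radon_ball inv.
  exists `|C| => r /andP[r0 r1]; rewrite (le_trans (hC r _)) ?r0//.
  rewrite (le_trans (ler_norm _))// normrM ler_wpM2l// ger0_norm ?exprn_ge0 ?(ltW r0)//.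
  by rewrite ler_wiXn2l// ltW.
pose D := \sum_h C h.
have up i : q ^- i.+1 <= D * (2^-1 ^+ i) ^+ l.
  have i0 : 0 < (2^-1 ^+ i : R) by rewrite exprn_gt0// invr_gt0.
  have i1 : (2^-1 ^+ i : R) <= 1 by rewrite exprn_ile1// ?invr_ge0// invf_le1 ?ler1n.
  apply: (le_trans (taulow i)); rewrite tauE//; last first.
  - exact: eballS.
  - exact: measurable_eball.
  rewrite (le_trans (ler_norm _))// (le_trans (ler_norm_sum _ _ _))//.
  by rewrite /D mulr_suml; apply: ler_sum => h _; apply: hC; rewrite i0 i1.
(* Multiplied by q^i, the bound up i reads q^-1 <= D z^i with z < 1. *)
pose z := q / 2 ^+ l.
have z0 : 0 <= z by rewrite divr_ge0 ?exprn_ge0// ltW.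
have z1 : `|z| < 1 by rewrite ger0_norm// ltr_pdivrMr ?exprn_gt0// mul1r.
have : q^-1 <= 0.
  have cv : D * z ^+ i @[i --> \oo] --> D * 0 by apply: cvgMr; exact: cvg_expr.
  rewrite mulr0 in cv; apply: (cvgr_to_ge cv); apply: nearW => i.
  have e2 : (2^-1 ^+ i) ^+ l = ((2 ^+ l)^-1) ^+ i :> R.
    by rewrite !exprVn -!exprM mulnC.
  rewrite /z exprMn mulrCA -ler_pdivrMl ?exprn_gt0// -e2.
  by apply: le_trans (up i); rewrite exprS invfM mulrC.
by rewrite leNgt invr_gt0 q0.
Qed.

(** * Sets that are null for a Hausdorff measure *)

Lemma powR2_gt1 (R : realType) (kappa : R) : 0 < kappa -> 1 < 2 `^ kappa :> R.
Proof.
move=> k0; apply: (@le_lt_trans _ _ (1 `^ kappa)); first by rewrite powR1.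
by rewrite gt0_ltr_powR// ?nnegrE// ltr1n.
Qed.

Lemma powR2_lt (R : realType) (kappa : R) (l : nat) :
  kappa < l%:R -> 2 `^ kappa < 2 ^+ l :> R.
Proof.
move=> kl; rewrite -powR_mulrn// -(subrK kappa l%:R) powRD; last first.
  by apply/implyP => _; rewrite pnatr_eq0.
by rewrite ltr_pMl ?powR_gt0// powR2_gt1// subr_gt0.
Qed.

Lemma powR_half (R : realType) (kappa : R) n :
  (2^-1 ^+ n) `^ kappa = (2 `^ kappa) ^- n :> R.
Proof. by rewrite exprVn -powR_invn// -powRrM mulrC powRrM powR_invn// powR_ge0. Qed.

Section hausdorff.
Context {R : realType} {d : nat}.
Implicit Types (A B : set 'rV[R]_d) (kappa delta eps : R).
Local Notation pow2 n := ((2^-1 : R) ^+ n).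

Lemma ediam_ge0 A x : A x -> (0 <= ediam A)%E.
Proof.
move=> Ax; apply: ereal_sup_ubound; exists x => //; exists x => //.
by rewrite subrr enorm0.
Qed.

Lemma enorm_le_ediam A x y : A x -> A y -> ((enorm (x - y))%:E <= ediam A)%E.
Proof. by move=> Ax Ay; apply: ereal_sup_ubound; exists x => //; exists y. Qed.

Lemma hausdorff_premeasure_le_measure kappa delta A : 0 < delta ->
  (hausdorff_premeasure kappa delta A <= hausdorff_measure kappa A)%E.
Proof. by move=> d0; apply: ereal_sup_ubound; exists delta. Qed.

Lemma hausdorff_measure_null_sub kappa A B : A `<=` B ->
  hausdorff_measure kappa B = 0%E -> (hausdorff_measure kappa A <= 0)%E.
Proof.
move=> AB B0; apply: ge_ereal_sup => _ [delta d0 <-]; rewrite -B0.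
apply: le_trans (hausdorff_premeasure_le_measure kappa B d0).
apply: le_ereal_inf_tmp => _ [P [E [BE PE ->]]].
by apply: ereal_inf_lbound; exists P, E; split => //; exact: subset_trans BE.
Qed.

Lemma hausdorff_null_ex kappa delta eps A : 0 < delta -> 0 < eps ->
  (hausdorff_measure kappa A <= 0)%E ->
  exists (P : pred nat) (E : nat -> set 'rV[R]_d),
    [/\ A `<=` \bigcup_(j in [set j | P j]) E j,
        forall j, P j -> E j !=set0 /\ (ediam (E j) <= delta%:E)%E &
        (\sum_(0 <= j <oo | P j) (ediam (E j) `^ kappa) < eps%:E)%E].
Proof.
move=> d0 e0 A0.
have : (hausdorff_premeasure kappa delta A < eps%:E)%E.
  apply: le_lt_trans (hausdorff_premeasure_le_measure _ _ d0) _.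
  by apply: le_lt_trans A0 _; rewrite lte_fin.
by move/ereal_inf_lt => [_ [P [E [AE PE ->]]] ?]; exists P, E.
Qed.

Lemma hausdorff0_null A : (hausdorff_measure 0 A <= 0)%E -> A = set0.
Proof.
move=> /(hausdorff_null_ex ltr01 ltr01)[P [E [AE PE]]].
rewrite ltNge => /negP sE; apply/seteqP; split => // x /AE[j /= Pj _].
apply: sE; rewrite (nneseriesD1 (n := j))//; last by move=> k _; exact: poweR_ge0.
by rewrite poweRe0 leeDl// nneseries_ge0// => k _ _; exact: poweR_ge0.
Qed.

(** When D > 0, the radius is the smallest power of 1/2 that exceeds D, so that
it is at most 2 D. When D = 0 any small radius does, and the error eta absorbs
its contribution. *)
Lemma dyadic_radius kappa (D eta : R) k1 : 0 < kappa -> 0 < eta ->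
  0 <= D -> D < pow2 k1 ->
  exists k, [/\ (k1 <= k)%N, D < pow2 k &
    (2 `^ kappa) ^- k <= 2 `^ kappa * D `^ kappa + eta].
Proof.
move=> kappa0 eta0; have q1 := powR2_gt1 kappa0; set q := 2 `^ kappa in q1 *.
have q0 : 0 < q by apply: lt_trans q1.
have half0 n : 0 < pow2 n by rewrite exprn_gt0// invr_gt0.
have cvhalf : pow2 n @[n --> \oo] --> (0 : R).
  by apply: cvg_expr; rewrite ger0_norm ?invr_ge0// invf_lt1 ?ltr1n.
rewrite le_eqVlt => /predU1P[<- _|D0 Dk1].
  have cvq : q^-1 ^+ n @[n --> \oo] --> (0 : R).
    by apply: cvg_expr; rewrite ger0_norm ?invr_ge0 ?(ltW q0)// invf_lt1.
  have [N _ hN] : \forall n \near \oo, q^-1 ^+ n <= eta.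
    have /cvgrPdist_le/(_ _ eta0) := cvq; apply: filterS => n.
    rewrite sub0r normrN ger0_norm// exprn_ge0// invr_ge0 ltW//.
  exists (maxn N k1); split; [exact: leq_maxr|exact: half0|].
  by rewrite powR0 ?gt_eqF// mulr0 add0r -exprVn; apply: hN => /=; exact: leq_maxl.
have exn : exists n, pow2 n <= D.
  have /cvgrPdist_le/(_ _ D0) := cvhalf => -[n _ hn]; exists n.
  by have := hn n (leqnn n); rewrite sub0r normrN ger0_norm// ltW.
case: (ex_minnP exn) => n nD nmin.
have k1n : (k1 < n)%N.
  rewrite ltnNge; apply/negP => nk1; move: (le_lt_trans nD Dk1).
  by apply/negP; rewrite -leNgt ler_wiXn2l// ?invr_ge0// invf_le1 ?ler1n.
case: n nD nmin k1n => // k kD kmin k1k; exists k; split => //.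
  by rewrite ltNge; apply/negP => /kmin; rewrite ltnn.
rewrite ler_wpDr ?(ltW eta0)// -ler_pdivrMl// -invfM -exprS -powR_half.
by apply: ge0_ler_powR; rewrite ?nnegrE ?(ltW kappa0) ?(ltW D0) ?(ltW (half0 _)).
Qed.

(** Replace each set of a cover that meets A by a dyadic ball centred at a point
of A in that set. The errors eps / 2^(j + 2), which are there for the sets of
diameter 0, are summable over j. *)
Lemma hausdorff_null_balls kappa A k1 eps : 0 < kappa -> 0 < eps ->
  (hausdorff_measure kappa A <= 0)%E ->
  exists (P : pred nat) (x : nat -> 'rV[R]_d) (k : nat -> nat),
    [/\ A `<=` \bigcup_(j in [set j | P j]) eball (x j) (pow2 (k j)),
        forall j, P j -> A (x j) /\ (k1 <= k j)%N &
        (\sum_(0 <= j <oo | P j) ((2 `^ kappa) ^- k j)%:E <= eps%:E)%E].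
Proof.
move=> kappa0 eps0 A0.
have q1 := powR2_gt1 kappa0; set q := 2 `^ kappa in q1 *.
have q0 : 0 < q by apply: lt_trans q1.
have delta0 : 0 < pow2 k1.+1 by rewrite exprn_gt0// invr_gt0.
have e0 : 0 < eps / 2 / q by rewrite !divr_gt0.
have [P [E [AE PE sE]]] := hausdorff_null_ex delta0 e0 A0.
pose Q : pred nat := [pred j | P j && `[< E j `&` A !=set0 >]].
have /choice[f hf] (j : nat) : exists p : 'rV[R]_d * nat, Q j ->
    [/\ A p.1, (k1 <= p.2)%N, E j `<=` eball p.1 (pow2 p.2) &
      ((q ^- p.2)%:E <= q%:E * ediam (E j) `^ kappa + (eps / 2 / (2 ^ j.+1)%:R)%:E)%E].
  have [Qj|] := boolP (Q j); last by exists (0, 0%N).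
  move: Qj => /= /andP[Pj /asboolP[x [Ex Ax]]]; have [_ diamd] := PE _ Pj.
  have Dfin : ediam (E j) \is a fin_num.
    rewrite ge0_fin_numE ?(ediam_ge0 Ex)//.
    by apply: le_lt_trans diamd _; rewrite ltry.
  have D0 : 0 <= fine (ediam (E j)) by rewrite fine_ge0// (ediam_ge0 Ex).
  have Dk : fine (ediam (E j)) < pow2 k1.
    apply: (@le_lt_trans _ _ (pow2 k1.+1)); first by rewrite -lee_fin fineK.
    by rewrite exprS gtr_pMl ?exprn_gt0 ?invr_gt0// invf_lt1 ?ltr1n.
  have eta0 : 0 < eps / 2 / (2 ^ j.+1)%:R by rewrite !divr_gt0// ltr0n expn_gt0.
  have [k [k1k Dlt kle]] := dyadic_radius kappa0 eta0 D0 Dk.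
  exists (x, k) => _; split => //=.
    move=> y Ey; apply: le_lt_trans Dlt; rewrite -lee_fin fineK//.
    exact: enorm_le_ediam.
  by rewrite -(fineK Dfin) poweR_EFin -EFinM -EFinD lee_fin.
exists Q, (fun j => (f j).1), (fun j => (f j).2); split.
- move=> y Ay; have [j /= Pj Ejy] := AE _ Ay.
  have Qj : Q j by apply/andP; split => //; apply/asboolP; exists y.
  by exists j => //; have [_ _ h _] := hf j Qj; exact: h.
- by move=> j /hf[].
have t0 j : (0 <= q%:E * ediam (E j) `^ kappa)%E.
  by rewrite mule_ge0 ?poweR_ge0// lee_fin ltW.
apply: (@le_trans _ _ (\sum_(0 <= j <oo | Q j)
    (q%:E * ediam (E j) `^ kappa + (eps / 2 / (2 ^ j.+1)%:R)%:E))%E).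
  apply: lee_nneseries => [j _ _|j /hf[]//].
  by rewrite lee_fin invr_ge0 exprn_ge0// ltW.
apply: le_trans (epsilon_trick _ t0 _) _; first by rewrite divr_ge0// ltW.
rewrite nneseriesZl; last by move=> j _; exact: poweR_ge0.
rewrite [in leRHS](splitr eps) EFinD leeD2r//.
apply: (@le_trans _ _ (q%:E * (eps / 2 / q)%:E)%E); last first.
  by rewrite -EFinM mulrC divfK// gt_eqF.
rewrite lee_pmul2l// ?lte_fin//; apply/ltW; apply: le_lt_trans sE.
by apply: subset_lee_nneseries => [j _|j /andP[]//]; exact: poweR_ge0.
Qed.

Lemma lebesgueRd_ge0 A : (0 <= lebesgueRd A)%E.
Proof.
apply: le_ereal_inf_tmp => _ [P [a [b [_ ->]]]]; apply: nneseries_ge0 => j _ _.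
by rewrite lee_fin prodr_ge0// => i _; rewrite le_max lexx.
Qed.

Lemma hausdorff_null_lebesgue kappa A : 0 < kappa <= d%:R ->
  (hausdorff_measure kappa A <= 0)%E -> lebesgueRd A = 0%E.
Proof.
move=> /andP[kappa0 kappad] A0; apply/eqP; rewrite eq_le lebesgueRd_ge0 andbT.
have q1 := powR2_gt1 kappa0; set q := 2 `^ kappa in q1 *.
have q0 : 0 < q by apply: lt_trans q1.
have qd : q <= 2 ^+ d by rewrite -powR_mulrn// /q ler_powR// ler1n.
apply/lee_addgt0Pr => e e0; rewrite add0e.
have e'0 : 0 < e / 2 ^+ d by rewrite divr_gt0// exprn_gt0.
have [P [x [k [Ax _ sP]]]] := hausdorff_null_balls 0%N kappa0 e'0 A0.
pose r j : 'rV[R]_d := const_mx (pow2 (k j)).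
apply: (@le_trans _ _ (\sum_(0 <= j <oo | P j)
    (box_volume (x j - r j) (x j + r j))%:E)%E).
  apply: ereal_inf_lbound; exists P, (fun j => x j - r j), (fun j => x j + r j).
  split => // y /Ax[j /= Pj yj]; exists j => // i.
  have := le_lt_trans (coord_le_enorm (y - x j) i) yj.
  rewrite !mxE ltr_norml => /andP[h1 h2]; apply/andP; split; first lra.
  by apply/ltW; lra.
apply: (@le_trans _ _ (\sum_(0 <= j <oo | P j) ((2 ^+ d)%:E * (q ^- k j)%:E))%E).
  apply: lee_nneseries => [j _ _|j _].
    by rewrite lee_fin prodr_ge0// => i _; rewrite le_max lexx.
  have p0 : 0 <= 2 * pow2 (k j) by rewrite mulr_ge0// exprn_ge0// invr_ge0.
  rewrite -EFinM lee_fin /box_volume (eq_bigr (fun=> 2 * pow2 (k j))); last first.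
    move=> i _; rewrite !mxE max_r; first by ring.
    by apply: le_trans p0 _; rewrite le_eqVlt; apply/orP; left; apply/eqP; ring.
  rewrite prodr_const card_ord exprMn ler_wpM2l ?exprn_ge0//.
  rewrite !exprVn -exprM mulnC exprM lef_pV2 ?posrE ?exprn_gt0//.
  by rewrite lerXn2r ?nnegrE ?exprn_ge0// ltW.
rewrite nneseriesZl; last by move=> j _; rewrite lee_fin invr_ge0 exprn_ge0// ltW.
apply: (@le_trans _ _ ((2 ^+ d)%:E * (e / 2 ^+ d)%:E)%E).
  by rewrite lee_pmul2l// lte_fin exprn_gt0.
by rewrite -EFinM mulrC divfK// gt_eqF// exprn_gt0.
Qed.

End hausdorff.

(** Split A into the countably many sets B m on which the bound holds with
constant m for all scales k >= m. The cover of [hausdorff_null_balls] can be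
chosen at these scales and with centres in B m, where the bound applies to each
ball. *)
Lemma growth_negligible (R : realType) (d : nat) (kappa : R)
    (mu : {measure set (borelRd R d) -> \bar R}) (A : set 'rV[R]_d) :
  0 < kappa -> (hausdorff_measure kappa A <= 0)%E ->
  (forall x, A x -> exists (C : R) (k0 : nat), forall k, (k0 <= k)%N ->
    (mu (eball x (2^-1 ^+ k)) <= (C * (2 `^ kappa) ^- k)%:E)%E) ->
  mu.-negligible (A : set (borelRd R d)).
Proof.
move=> kappa0 A0 growth; set q := 2 `^ kappa in growth *.
have q0 : 0 < q by rewrite powR_gt0.
pose B (m : nat) := A `&` [set x | forall k, (m <= k)%N ->
  (mu (eball x (2^-1 ^+ k)) <= (m%:R * q ^- k)%:E)%E].
have AB : A `<=` \bigcup_m B m.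
  move=> x Ax; have [C [k0 hC]] := growth x Ax.
  exists (maxn k0 (Num.truncn C).+1) => //; split => // k;
    rewrite geq_max => /andP[k0k Ck].
  apply: le_trans (hC k k0k) _; rewrite lee_fin ler_wpM2r//.
    by rewrite invr_ge0 exprn_ge0// ltW.
  apply: le_trans (ltW (truncnS_gt C)) _; rewrite ler_nat; exact: leq_maxr.
apply: (@negligibleS _ (borelRd R d) _ mu _ _ AB); apply: negligible_bigcup => m.
have B0 : (hausdorff_measure kappa (B m) <= 0)%E.
  apply: le_trans A0; apply: ge_ereal_sup => _ [delta d0 <-].
  apply: le_trans (hausdorff_premeasure_le_measure kappa A d0).
  apply: le_ereal_inf_tmp => _ [P [E [AE PE ->]]].
  apply: ereal_inf_lbound; exists P, E; split => //.
  by apply: subset_trans AE => x [].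
have /choice[U hU] (i : nat) : exists U : set (borelRd R d),
    [/\ measurable U, B m `<=` U & (mu U <= (m%:R * i.+1%:R^-1)%:E)%E].
  have e0 : 0 < i.+1%:R^-1 :> R by rewrite invr_gt0.
  have [P [x [k [BU Px sP]]]] := hausdorff_null_balls m kappa0 e0 B0.
  pose F j : set (borelRd R d) := if P j then eball (x j) (2^-1 ^+ k j) else set0.
  have mF j : measurable (F j).
    by rewrite /F; case: ifP => _; [exact: measurable_eball|exact: measurable0].
  exists (\bigcup_j F j); split; first exact: bigcup_measurable.
    by move=> y /BU[j /= Pj yj]; exists j => //; rewrite /F Pj.
  apply: (@le_trans _ _ (\sum_(0 <= j <oo) mu (F j))%E).
    by apply: measure_sigma_subadditive => //; exact: bigcup_measurable.
  apply: (@le_trans _ _ (\sum_(0 <= j <oo | P j) (m%:R%:E * (q ^- k j)%:E))%E).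
    rewrite [leRHS]eseries_mkcond; apply: lee_nneseries => [j _ _|j _];
      first exact: measure_ge0.
    rewrite /F; case: ifPn => Pj; last by rewrite measure0.
    by have [[_ h] mk] := Px j Pj; rewrite -EFinM; exact: h.
  rewrite nneseriesZl; last by move=> j _; rewrite lee_fin invr_ge0 exprn_ge0// ltW.
  by rewrite EFinM lee_wpmul2l// lee_fin.
exists (\bigcap_i U i); split.
- by apply: bigcap_measurable => // i _; have [] := hU i.
- apply/eqP; rewrite eq_le measure_ge0 andbT; apply/lee_addgt0Pr => e e0; rewrite add0e.
  have [//|i] := @ltr_add_invr R 0 (e / m.+1%:R) _; first by rewrite divr_gt0.
  rewrite add0r => ie; have [mU _ muU] := hU i.
  apply: (@le_trans _ _ (mu (U i))).
    apply: le_measure; [apply/mem_set|exact/mem_set|exact: bigcap_inf].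
    by apply: bigcap_measurable => // j _; have [] := hU j.
  apply: le_trans muU _; rewrite lee_fin; apply/ltW.
  apply: (@le_lt_trans _ _ (m.+1%:R * i.+1%:R^-1)).
    by rewrite ler_wpM2r ?invr_ge0// ler_nat.
  by rewrite mulrC -ltr_pdivlMr.
- by move=> x Bx i _; have [_ h _] := hU i; exact: h.
Qed.

Lemma small_balls_in_compact (R : realType) (d : nat) (Omega : set 'rV[R]_d) x :
  open Omega -> Omega x -> exists (K : set 'rV[R]_d) (k0 : nat),
    [/\ compact K, K `<=` Omega &
      forall k, (k0 <= k)%N -> eball x (2^-1 ^+ k) `<=` K].
Proof.
move=> oO Ox; have /nbhs_ballP[e /= e0 eO] : nbhs x Omega by exact: open_nbhs_nbhs.
pose K : set 'rV[R]_d := [set y | forall i,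
  (`[x 0 i - e / 2, x 0 i + e / 2]%classic : set R) (y ord0 i)].
have cvhalf : (2^-1 : R) ^+ n @[n --> \oo] --> (0 : R).
  by apply: cvg_expr; rewrite ger0_norm ?invr_ge0// invf_lt1 ?ltr1n.
have e20 : 0 < e / 2 by rewrite divr_gt0.
have /cvgrPdist_le/(_ _ e20)[k0 _ hk0] := cvhalf.
exists K, k0; split.
- exact: (@rV_compact R d (fun i => `[x 0 i - e / 2, x 0 i + e / 2]%classic)
    (fun i => @segment_compact _ _ _)).
- move=> y Ky; apply: eO; rewrite mx_norm_ball /ball_/= /Num.norm/= mx_normrE.
  apply/bigmax_ltP; split => // -[i j] _ /=; rewrite (ord1 i) !mxE.
  have := Ky j; rewrite /= in_itv/= => /andP[h1 h2].
  by rewrite ltr_norml; apply/andP; split; lra.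
- move=> k k0k y yk i; rewrite /= in_itv/=.
  have := hk0 k k0k; rewrite /= sub0r normrN ger0_norm ?exprn_ge0 ?invr_ge0// => ke.
  have := le_trans (coord_le_enorm (y - x) i) (le_trans (ltW yk) ke).
  by rewrite !mxE ler_norml => /andP[h1 h2]; apply/andP; split; lra.
Qed.

(** * Lower bound for the Hausdorff dimension *)

Theorem lemma9 (R : realType) (d l : nat) (Omega : set 'rV[R]_d)
    (sigma sigma_a sigma_s : {measure set (borelRd R d) -> \bar R}) (k : nat)
    (openOmega : open Omega) (le_ld : (l <= d)%N)
    (sigma_radon : radon_on Omega sigma)
    (sigma_dec : lebesgue_decomposition sigma sigma_a sigma_s)
    (tangent_split : {ae sigma_s, forall x, Omega x ->
      forall tau : real_radon (eclosed_ball 0 1), tangent_measure sigma_s x tau ->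
      exists (t : 'I_k -> real_radon setT) (V : 'I_k -> {vspace 'rV[R]_d}),
        (forall h, invariant_radon (V h) (t h) /\ (l <= \dim (V h))%N) /\
        (forall A : set (borelRd R d), measurable A -> A `<=` eball 0 1 ->
           rr_val tau A = \sum_(h < k) rr_val (t h) A)}) :
  (l%:R%:E <= hausdorff_dim sigma)%E.
Proof.
have [dec sa_leb _] := sigma_dec; have [sigmaC sigmaK] := sigma_radon.
have mOmega : measurable (Omega : set (borelRd R d)) by exact: sub_sigma_algebra.
have sle A : measurable (A : set (borelRd R d)) -> (sigma_s A <= sigma A)%E.
  by move=> mA; rewrite dec// leeDr.
have [l0|l_gt0] := posnP l.
  apply: ereal_sup_ubound; exists 0 => /=; last by rewrite l0.
  split; first by rewrite lexx ler0n.
  move=> A A0 B mB BA; have := A0 B mB BA => B0.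
  by rewrite (@hausdorff0_null _ _ B) ?measure0// B0.
suff dom kappa : 0 < kappa < l%:R -> sigma `<< hausdorff_measure kappa.
  have l0 : 0 < l%:R :> R by rewrite ltr0n.
  apply/lee_addgt0Pr => e e0.
  pose kappa : R := l%:R - Num.min e (l%:R / 2).
  have kappa0 : 0 < kappa.
    by rewrite /kappa subr_gt0 gt_min; apply/orP; right; lra.
  have kappal : kappa < l%:R.
    by rewrite /kappa ltrBlDr ltrDl lt_min e0 divr_gt0.
  apply: (@le_trans _ _ (kappa%:E + e%:E)%E).
    by rewrite -EFinD lee_fin /kappa -addrA lerDl addrC subr_ge0 ge_min lexx.
  rewrite leeD2r//; apply: ereal_sup_ubound; exists kappa => //=; split.
    by rewrite (ltW kappa0) (le_trans (ltW kappal))// ler_nat.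
  by apply: dom; rewrite kappa0.
move=> /andP[kappa0 kappal] N N0 A mA AN.
have A0 : hausdorff_measure kappa A = 0%E by exact: N0.
have kappad : 0 < kappa <= d%:R.
  by rewrite kappa0 (le_trans (ltW kappal))// ler_nat.
rewrite dec// (sa_leb A)//; last first.
  move=> B mB BA; apply: (hausdorff_null_lebesgue kappad).
  exact: hausdorff_measure_null_sub A0.
rewrite add0e; apply: (measure_negligible mA).
have C0 : sigma_s.-negligible (~` Omega : set (borelRd R d)).
  apply/negligibleP; first exact: measurableC.
  apply/eqP; rewrite eq_le measure_ge0 andbT -sigmaC; apply: sle.
  exact: measurableC.
have [N' [mN' N'0 badN']] := tangent_split.
have Gneg : sigma_s.-negligible (A `&` (Omega `\` N')).
  apply: (@growth_negligible _ _ kappa) => //.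
    by apply: (hausdorff_measure_null_sub (B := A)) => // x [].
  move=> x [Ax [Ox xN']]; have Gx := contrapT (fun bad => xN' (badN' x bad)).
  have [K [k0 [cK KO hK]]] := small_balls_in_compact openOmega Ox.
  have fin j : (k0 <= j)%N -> (sigma_s (eball x (2^-1 ^+ j)) < +oo)%E.
    move=> k0j; apply: (@le_lt_trans _ _ (sigma K)); last exact: sigmaK.
    apply: le_trans (sle _ (measurable_eball _ _)) _; apply: le_measure.
    - apply/mem_set; exact: measurable_eball.
    - apply/mem_set; apply: closed_measurable_borelRd.
      by apply: compact_closed => //; exact: norm_hausdorff.
    - exact: hK.
  have q12 : 1 <= 2 `^ kappa < 2 ^+ l.
    by rewrite (ltW (powR2_gt1 kappa0)) powR2_lt.
  have [C hC] := split_tangent_growth q12 fin (Gx Ox).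
  by exists C, k0.
have N'neg : sigma_s.-negligible N' by exact/negligibleP.
apply: (@negligibleS _ (borelRd R d) _ sigma_s _ _ _
  (negligibleU (negligibleU C0 N'neg) Gneg)).
move=> x Ax; have [Ox|] := pselect (Omega x); last by left; left.
have [Nx|] := pselect (N' x); first by left; right.
by right.
Qed.
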